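(* Suppose there exist a measurable function $w:S\to[1,\infty)$ and constants $\rho\ge0$, $b\ge0$, $M\ge0$, $c\ge0$ such that: (i) $\int_S q(dy|x,a)w(y)\le\rho w(x)+b$ for all $x\in S$, $a\in A(x)$; (ii) $\alpha>\rho$; (iii) $|\inf_{a\in A(x)}c_0(x,a)|\le Mw(x)+c$ for all $x\in S$; (iv) for every bounded nonnegative measurable function $u$ on $S$ and every fixed $x\in S$, the function $a\mapsto\int_S u(y)q(dy|x,a)$ is lower semicontinuous on $A(x)$; (v) for every $x\in S$, the function $a\mapsto\int_S w(y)q(dy|x,a)$ is continuous on $A(x)$; (vi) for every $x\in S$, $c_0(x,a)$ is lower semicontinuous in $a\in A(x)$; (vii) $A(x)$ is compact for every $x\in S$. Then the Bellman equation $$\alpha u(x)=\inf_{a\in A(x)}\left\{c_0(x,a)+\int_S q(dy|x,a)u(y)\right\},\quad x\in S,$$ admits a solution $u^*\in\mathbf B_w(S)$, which is given by the pointwise limit of the following non-increasing sequence of measurable functions $\{u^{(n)},n=0,1,\dots\}$: $$u^{(0)}(x):=\frac{M(\alpha w(x)+b)}{\alpha(\alpha-\rho)}+\frac{c}{\alpha},$$ $$u^{(n+1)}(x):=\inf_{a\in A(x)}\left\{\frac{c_0(x,a)}{\alpha+1+\bar q_x}+\frac{1+\bar q_x}{\alpha+1+\bar q_x}\int_S u^{(n)}(y)\left(\frac{q(dy|x,a)}{1+\bar q_x}+\delta_x(dy)\right)\right\}.$$ Moreover, for each $n=0,1,2,\dots$ and $x\in S$, $$|u^{(n)}(x)|\le\frac{M(\alpha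 w(x)+b)}{\alpha(\alpha-\rho)}+\frac{c}{\alpha}.$$
   Context: $S$ and $A$ are Borel spaces (state and action spaces) with Borel $\sigma$-algebras $\mathcal B(S),\mathcal B(A)$. For each $x\in S$, $A(x)\in\mathcal B(A)$ is the set of admissible actions; $K=\{(x,a)\in S\times A:a\in A(x)\}$ is a Borel subset of $S\times A$ containing the graph of a measurable function from $S$ to $A$. The transition rate $q(dy|x,a)$ is a signed kernel on $\mathcal B(S)$ given $(x,a)\in K$ with $q(\Gamma\setminus\{x\}|x,a)\ge0$ for all $\Gamma\in\mathcal B(S)$, $q(S|x,a)=0$, and $\bar q_x:=\sup_{a\in A(x)}q_x(a)<\infty$ for each $x$, where $q_x(a):=-q(\{x\}|x,a)$. The cost rate $c_0:K\to\mathbb R$ is measurable and $\alpha>0$ is the discount factor. $\delta_x$ is the Dirac measure at $x$. $\mathbf B_w(S)$ is the set of measurable functions $u:S\to\mathbb R$ with $\sup_{x\in S}|u(x)|/w(x)<\infty$. *)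

(* Defs.v *)
From HB Require Import structures.
From mathcomp Require Import all_boot all_order all_algebra.
From mathcomp Require Import all_classical all_reals all_analysis.
From mathcomp Require Import measurable_realfun.

Set Implicit Arguments.
Unset Strict Implicit.
Unset Printing Implicit Defensive.

Import Order.TTheory GRing.Theory Num.Theory.
Import numFieldNormedType.Exports.

Local Open Scope classical_set_scope.
Local Open Scope ring_scope.

Notation borel T := (g_sigma_algebraType (@open T)).

(* T is homeomorphic to a Borel subset of a complete separable metric space *)
Definition borel_space (R : realType) (T : topologicalType) : Prop :=
  exists (P : metricType R) (B : set P),
    [/\ forall F : set_system P, ProperFilter F -> cauchy F -> exists p : P, F --> p,
        exists2 D : set P, countable D & dense D,
        <<s @open P >> B
      & exists (f : T -> set_type B) (g : set_type B -> T),
          [/\ cancel f g, cancel g f, continuous f & continuous g]].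

(* The type [subspace D] isolates the points outside of D, so this only
   constrains f on D, with the topology of D. *)
Definition lower_semicontinuous_on (R : realType) (T : topologicalType)
    (D : set T) (f : T -> \bar R) : Prop :=
  @lower_semicontinuous (subspace D) R f.

(* The integral against a signed measure is the difference of the integrals
   against the two parts of its Jordan decomposition, which do not depend on the
   chosen Hahn decomposition. *)
Definition charge_integral d (T : measurableType d) (R : realType)
    (nu : {charge set T -> \bar R}) (f : T -> \bar R) : \bar R :=
  let: exist _ exN := cid (Hahn_decomposition nu) in
  let: exist _ nuPN := cid exN in
  (\int[jordan_pos nuPN]_y f y - \int[jordan_neg nuPN]_y f y)%E.

Section ctmdp.
Variables (R : realType) (S A : ptopologicalType).
Variable adm : S -> set A.
Variable q : S -> A -> {charge set (borel S) -> \bar R}.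
Variable c0 : S -> A -> R.
Variable alpha : R.

Definition state_action : set (borel S * borel A) :=
  [set xa | adm xa.1 xa.2].

Definition exit_rate (x : S) (a : A) : \bar R := (- q x a [set x])%E.

Definition exit_rate_sup (x : S) : \bar R :=
  ereal_sup [set exit_rate x a | a in adm x].

Definition uniformized_rate (x : S) (a : A) : {charge set (borel S) -> \bar R} :=
  cadd (cscale (1 + fine (exit_rate_sup x))^-1 (q x a))
       (charge_of_finite_measure (@dirac _ (borel S) x R)).

Fixpoint value_iteration (u0 : S -> R) (n : nat) : S -> \bar R :=
  if n is m.+1 then
    fun x => let qx := fine (exit_rate_sup x) in
      ereal_inf [set ((c0 x a / (alpha + 1 + qx))%:E +
                      ((1 + qx) / (alpha + 1 + qx))%:E *
                      charge_integral (uniformized_rate x a)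
                        (value_iteration u0 m))%E
                | a in adm x]
  else EFin \o u0.

Definition bellman_equation (u : S -> R) : Prop :=
  forall x, (alpha * u x)%:E =
    ereal_inf [set ((c0 x a)%:E + charge_integral (q x a) (EFin \o u))%E
              | a in adm x].

Definition weighted_bounded (w u : S -> R) : Prop :=
  measurable_fun [set: borel S] u /\
  (ereal_sup (range (fun x => (`|u x| / w x)%:E)) < +oo)%E.

End ctmdp.

(* Main.v *)
Require Import Defs.
From HB Require Import structures.
From mathcomp Require Import all_boot all_order all_algebra.
From mathcomp Require Import all_classical all_reals all_analysis.
From mathcomp Require Import measurable_realfun.
From mathcomp Require Import ring lra.

Set Implicit Arguments.
Unset Strict Implicit.
Unset Printing Implicit Defensive.

Import Order.TTheory GRing.Theory Num.Theory.
Import numFieldNormedType.Exports.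

(** Let T send u to the infimum over the admissible actions a of
    (c0 x a + generator u x a + (1 + qbar x) u x) / (alpha + 1 + qbar x), where
    generator u x a is the integral of u against q(.|x,a). Adding
    (1 + qbar x) u x to both sides of the Bellman equation and dividing by the
    total rate gives u = T u, and the value iteration is u (n+1) = T (u n). Since q(.|x,a) / (1 + qbar x)
    plus the Dirac mass at x is a probability, T is monotone. The drift
    condition makes the initial bound a supersolution and its opposite a
    subsolution ([optimal_cost_bound]), so the iterates decrease and stay
    between the two; let u* be their limit. One has T u* <= T (u n) = u (n+1),
    hence T u* <= u*. Conversely u (n+1) is at most the cost of u n under each
    action a, and dominated convergence passes this to the limit, so that
    u* <= T u*.

    The integrals against the charges q(.|x,a) reduce to integrals against
    measures because such a charge is nonnegative off x: its negative part is a
    multiple of the Dirac mass at x ([charge_integral_one_point]).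

    The delicate point is that every iterate is measurable, because the
    sublevel sets of an infimum over uncountably many actions are in general
    only analytic. The
    minimized function is jointly measurable ([measurable_charge_integral]) and
    lower semicontinuous in the action ([generator_lsc]); its sublevel sets are
    therefore Borel sets with compact sections, and the projection of such a
    set is Borel ([measurable_projection_compact_sections]). This is a theorem
    of Novikov, proved here along the classical lines: countably many analytic
    sets with empty intersection are separated by Borel sets with empty
    intersection ([novikov_separation]); hence a Borel set with open sections
    is a countable union of Borel rectangles ([borel_open_sections]); hence
    emptiness of a compact section is witnessed by a finite cover taken from
    countably many ([borel_projection_compact_sections]). *)

Local Open Scope classical_set_scope.

(** * Analytic sets *)

Definition agree (s : seq nat) (t u : nat -> nat) := {in s, t =1 u}.

(** Closedness in the product topology on sequences, whose basic neighbourhoods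
    are given by finite sets of coordinates. *)
Definition closed_code (C : set (nat -> nat)) :=
  forall u, (forall s, exists2 t, C t & agree s t u) -> C u.

(** Continuity of [f] on the codes, not for a topology on [T] but for the finer
    one that makes every [D n] clopen. The preimages of the [D n] are then
    clopen, so that Borel sets are analytic without any change of topology. *)
Definition locally_decided T (D : nat -> set T) (C : set (nat -> nat))
    (f : (nat -> nat) -> T) :=
  forall u n, C u -> exists s, forall t, C t -> agree s t u ->
    (D n (f t) <-> D n (f u)).

Definition analytic T (D : nat -> set T) (E : set T) :=
  exists (C : set (nat -> nat)) (f : (nat -> nat) -> T),
    [/\ closed_code C, locally_decided D C f & f @` C = E].

Definition separating T (D : nat -> set T) :=
  forall x y, (forall n, D n x <-> D n y) -> x = y.

Notation borel_of D := (<<s range D >>).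

Definition slice (i : nat) (t : nat -> nat) : nat -> nat :=
  fun n => t (pickle (i, n)).

Lemma agree_slice i s t u :
  agree [seq pickle (i, n) | n <- s] t u -> agree s (slice i t) (slice i u).
Proof. by move=> tu n ns; apply: tu; apply/map_f. Qed.

Section analytic_closure.
Variables (T : Type) (D : nat -> set T).

Lemma analytic_bigcup (E : nat -> set T) :
  (forall i, analytic D (E i)) -> analytic D (\bigcup_i E i).
Proof.
move=> aE.
have /choice[Cf HCf] : forall i, exists Cf : set (nat -> nat) * ((nat -> nat) -> T),
    [/\ closed_code Cf.1, locally_decided D Cf.1 Cf.2 & Cf.2 @` Cf.1 = E i].
  by move=> i; have [C [f H]] := aE i; exists (C, f).
pose tl (t : nat -> nat) := t \o S.
have agree_tl s t u : agree [seq n.+1 | n <- s] t u -> agree s (tl t) (tl u).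
  by move=> tu n ns; apply: tu; apply/map_f.
exists (fun t => (Cf (t 0)).1 (tl t)), (fun t => (Cf (t 0)).2 (tl t)); split.
- move=> u Hu; have [clC _ _] := HCf (u 0); apply: clC => s.
  have [t Ct tu] := Hu (0 :: [seq n.+1 | n <- s]).
  exists (tl t); last by apply: agree_tl => n ns; apply: tu; rewrite inE ns orbT.
  by rewrite -(tu 0) ?inE.
- move=> u n Cu; have [_ dC _] := HCf (u 0); have [s Hs] := dC _ n Cu.
  exists (0 :: [seq n.+1 | n <- s]) => t + tu.
  rewrite (tu 0) ?inE// => Ct; apply: Hs => //.
  by apply: agree_tl => k ks; apply: tu; rewrite inE ks orbT.
- apply/seteqP; split=> [_ [t Ct <-]|x [i _]].
    by exists (t 0) => //; have [_ _ <-] := HCf (t 0); exists (tl t).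
  have [_ _ <-] := HCf i; move=> [t Ct <-].
  by exists (fun n => if n is m.+1 then t m else i).
Qed.

(** A point of the intersection is coded by the codes of it in all the sets,
    interleaved. That they code the same point is a closed condition, because
    two distinct points are told apart by some [D n]. *)
Lemma analytic_bigcap (E : nat -> set T) : separating D ->
  (forall i, analytic D (E i)) -> analytic D (\bigcap_i E i).
Proof.
move=> sepD aE.
have /choice[Cf HCf] : forall i, exists Cf : set (nat -> nat) * ((nat -> nat) -> T),
    [/\ closed_code Cf.1, locally_decided D Cf.1 Cf.2 & Cf.2 @` Cf.1 = E i].
  by move=> i; have [C [f H]] := aE i; exists (C, f).
pose C t := forall i, (Cf i).1 (slice i t) /\
  (Cf i).2 (slice i t) = (Cf 0).2 (slice 0 t).
exists C, (fun t => (Cf 0).2 (slice 0 t)); split.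
- move=> u Hu.
  have Cu i : (Cf i).1 (slice i u).
    have [clC _ _] := HCf i; apply: clC => s.
    have [t Ct tu] := Hu [seq pickle (i, n) | n <- s].
    by exists (slice i t); [case: (Ct i)|exact: agree_slice].
  move=> i; split => //; apply: sepD => n.
  have [_ dC _] := HCf i; have [s Hs] := dC _ n (Cu i).
  have [_ dC0 _] := HCf 0; have [s0 Hs0] := dC0 _ n (Cu 0).
  have [t Ct tu] :=
    Hu ([seq pickle (i, n) | n <- s] ++ [seq pickle (0, n) | n <- s0]).
  have [Cti eti] := Ct i; have [Ct0 _] := Ct 0.
  have e1 : agree s (slice i t) (slice i u).
    by apply: agree_slice => k ks; apply: tu; rewrite mem_cat ks.
  have e2 : agree s0 (slice 0 t) (slice 0 u).
    by apply: agree_slice => k ks; apply: tu; rewrite mem_cat ks orbT.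
  have := Hs _ Cti e1; have := Hs0 _ Ct0 e2; rewrite eti; tauto.
- move=> u n Cu; have [_ dC _] := HCf 0.
  have [s Hs] := dC _ n (Cu 0).1; exists [seq pickle (0, n) | n <- s] => t Ct tu.
  by apply: Hs; [exact: (Ct 0).1|exact: agree_slice].
- apply/seteqP; split=> [_ [t Ct <-] i _|x Ex].
    by have [_ _ <-] := HCf i; have [? <-] := Ct i; exists (slice i t).
  have /choice[u Hu] : forall i, exists u, (Cf i).1 u /\ (Cf i).2 u = x.
    by move=> i; have := Ex i I; have [_ _ <-] := HCf i => -[u ? ?]; exists u.
  pose t m := if unpickle m is Some (i, n) then u i n else 0.
  have tE i : slice i t = u i by apply/funext => n; rewrite /slice /t pickleK.
  exists t; last by rewrite tE; case: (Hu 0).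
  by move=> i; rewrite !tE; split; [case: (Hu i)|case: (Hu i) => _ ->; case: (Hu 0)].
Qed.

Lemma analytic0 : analytic D setT -> analytic D set0.
Proof.
move=> [C [f _]]; exists set0, f; split.
- by move=> u /(_ [::])[].
- by move=> u n [].
- by rewrite image_set0.
Qed.

Lemma analyticU E F : analytic D E -> analytic D F -> analytic D (E `|` F).
Proof.
move=> aE aF; rewrite (_ : E `|` F = \bigcup_i (if i is 0 then E else F)).
  by apply: analytic_bigcup => -[].
apply/seteqP; split=> [x [Ex|Fx]|x [[|i] _]]; [by exists 0|by exists 1|by left|by right].
Qed.

Lemma analyticI E F : separating D -> analytic D E -> analytic D F ->
  analytic D (E `&` F).
Proof.
move=> sepD aE aF; rewrite (_ : E `&` F = \bigcap_i (if i is 0 then E else F)).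
  by apply: analytic_bigcap => // -[].
by apply/seteqP; split=> [x [Ex Fx] [|i]//|x H]; split; [apply: (H 0)|apply: (H 1)].
Qed.

(** A clopen subset of the codes of [T] codes each basic set. *)
Lemma analytic_basic n : analytic D setT -> analytic D (D n) /\ analytic D (~` D n).
Proof.
move=> [C [f [clC dC fC]]]; split.
- exists (C `&` f @^-1` D n), f; split.
  + move=> u Hu.
    have Cu : C u by apply: clC => s; have [t [Ct _] tu] := Hu s; exists t.
    split => //; have [s Hs] := dC u n Cu; have [t [Ct Dt] tu] := Hu s.
    exact/(Hs _ Ct tu).
  + by move=> u m [Cu _]; have [s Hs] := dC u m Cu; exists s => t [Ct _]; exact: Hs.
  + apply/seteqP; split=> [_ [t [Ct Dt] <-]//|x Dx].
    have : [set: T] x by [].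
    by rewrite -fC => -[t Ct tx]; exists t => //; split => //=; rewrite tx.
- exists (C `&` f @^-1` (~` D n)), f; split.
  + move=> u Hu.
    have Cu : C u by apply: clC => s; have [t [Ct _] tu] := Hu s; exists t.
    split => //; have [s Hs] := dC u n Cu; have [t [Ct Dt] tu] := Hu s.
    by move=> Du; apply: Dt; exact/(Hs _ Ct tu).
  + by move=> u m [Cu _]; have [s Hs] := dC u m Cu; exists s => t [Ct _]; exact: Hs.
  + apply/seteqP; split=> [_ [t [Ct Dt] <-]//|x Dx].
    have : [set: T] x by [].
    by rewrite -fC => -[t Ct tx]; exists t => //; split => //=; rewrite tx.
Qed.

(** The sets that are analytic together with their complement form a
    sigma-algebra. *)
Lemma analytic_borel E : separating D -> analytic D setT ->
  borel_of D E -> analytic D E.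
Proof.
move=> sepD aT bE.
suff : borel_of D `<=` [set E | analytic D E /\ analytic D (~` E)].
  by move=> /(_ E bE)[].
apply: smallest_sub; last by move=> _ [n _ <-]; exact: analytic_basic.
split.
- by split; [exact: analytic0|rewrite setC0].
- by move=> A [aA aCA]; split; rewrite setTD ?setCK.
- move=> F HF; split; first by apply: analytic_bigcup => i; case: (HF i).
  by rewrite setC_bigcup; apply: analytic_bigcap => // i; case: (HF i).
Qed.

End analytic_closure.

Lemma analytic_image T T' (D : nat -> set T) (D' : nat -> set T') (h : T -> T')
    (E : set T) :
  (forall n, exists m, forall x, E x -> (D' n (h x) <-> D m x)) ->
  analytic D E -> analytic D' (h @` E).
Proof.
move=> hD [C [f [clC dC fC]]]; exists C, (h \o f); split => //.
- move=> u n Cu; have [m Hm] := hD n; have [s Hs] := dC u m Cu.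
  have HmC t : C t -> (D' n (h (f t)) <-> D m (f t)).
    by move=> Ct; apply: Hm; rewrite -fC; exists t.
  exists s => t Ct tu /=; have := Hs t Ct tu.
  by have := HmC t Ct; have := HmC u Cu; tauto.
- by rewrite -fC image_comp.
Qed.

Definition prod_basis T1 T2 (D1 : nat -> set T1) (D2 : nat -> set T2) :
    nat -> set (T1 * T2) :=
  fun n => if odd n then snd @^-1` D2 n./2 else fst @^-1` D1 n./2.

Section analytic_product.
Variables (T1 T2 : Type) (D1 : nat -> set T1) (D2 : nat -> set T2).

Lemma prod_basis_fst n : prod_basis D1 D2 n.*2 = fst @^-1` D1 n.
Proof. by rewrite /prod_basis odd_double doubleK. Qed.

Lemma prod_basis_snd n : prod_basis D1 D2 n.*2.+1 = snd @^-1` D2 n.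
Proof. by rewrite /prod_basis /= odd_double /= uphalf_double. Qed.

Lemma separating_prod : separating D1 -> separating D2 ->
  separating (prod_basis D1 D2).
Proof.
move=> s1 s2 [x1 x2] [y1 y2] H; congr pair.
  by apply: s1 => n; have := H n.*2; rewrite prod_basis_fst.
by apply: s2 => n; have := H n.*2.+1; rewrite prod_basis_snd.
Qed.

Lemma analyticX E1 E2 : analytic D1 E1 -> analytic D2 E2 ->
  analytic (prod_basis D1 D2) (E1 `*` E2).
Proof.
move=> [C1 [f1 [cl1 d1 fC1]]] [C2 [f2 [cl2 d2 fC2]]].
exists [set t | C1 (slice 0 t) /\ C2 (slice 1 t)],
       (fun t => (f1 (slice 0 t), f2 (slice 1 t))); split.
- move=> u Hu; split.
    apply: cl1 => s; have [t [Ct _] tu] := Hu [seq pickle (0, n) | n <- s].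
    by exists (slice 0 t) => //; exact: agree_slice.
  apply: cl2 => s; have [t [_ Ct] tu] := Hu [seq pickle (1, n) | n <- s].
  by exists (slice 1 t) => //; exact: agree_slice.
- move=> u n [Cu1 Cu2]; rewrite /prod_basis; case: ifP => _ /=.
    have [s Hs] := d2 _ n./2 Cu2; exists [seq pickle (1, n) | n <- s].
    by move=> t [_ Ct] tu; apply: Hs => //; exact: agree_slice.
  have [s Hs] := d1 _ n./2 Cu1; exists [seq pickle (0, n) | n <- s].
  by move=> t [Ct _] tu; apply: Hs => //; exact: agree_slice.
- apply/seteqP; split=> [_ [t [Ct1 Ct2] <-]|[x y] []/=].
    by rewrite -fC1 -fC2; split; [exists (slice 0 t)|exists (slice 1 t)].
  rewrite -fC1 -fC2 => -[t1 Ct1 <-] [t2 Ct2 <-].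
  pose t m := if unpickle m is Some (i, n) then
                if i is 0 then t1 n else t2 n else 0.
  have t1E : slice 0 t = t1 by apply/funext => n; rewrite /slice /t pickleK.
  have t2E : slice 1 t = t2 by apply/funext => n; rewrite /slice /t pickleK.
  by exists t; rewrite /= t1E t2E.
Qed.

Lemma analytic_fst E : analytic (prod_basis D1 D2) E -> analytic D1 (fst @` E).
Proof.
by apply: analytic_image => n; exists n.*2 => x _; rewrite prod_basis_fst.
Qed.

End analytic_product.

(** * Separation of analytic sets *)

Lemma borel_of0 T (D : nat -> set T) : borel_of D set0.
Proof. exact: sigma_algebra0. Qed.

Lemma borel_ofC T (D : nat -> set T) E : borel_of D E -> borel_of D (~` E).
Proof. by move=> bE; have := sigma_algebraCD bE; rewrite setTD. Qed.

Lemma borel_ofT T (D : nat -> set T) : borel_of D setT.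
Proof. by have := borel_ofC (@borel_of0 T D); rewrite setC0. Qed.

Lemma borel_of_bigcup T (D : nat -> set T) (E : nat -> set T) :
  (forall i, borel_of D (E i)) -> borel_of D (\bigcup_i E i).
Proof. exact: sigma_algebra_bigcup. Qed.

Lemma borel_of_bigcap T (D : nat -> set T) (E : nat -> set T) :
  (forall i, borel_of D (E i)) -> borel_of D (\bigcap_i E i).
Proof.
move=> bE; rewrite -[X in borel_of D X]setCK setC_bigcap.
by apply: borel_ofC; apply: borel_of_bigcup => i; exact: borel_ofC.
Qed.

Lemma borel_ofI T (D : nat -> set T) E F :
  borel_of D E -> borel_of D F -> borel_of D (E `&` F).
Proof.
move=> bE bF; rewrite (_ : E `&` F = \bigcap_i (if i is 0 then E else F)).
  by apply: borel_of_bigcap => -[].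
by apply/seteqP; split=> [x [Ex Fx] [|i]//|x H]; split; [apply: (H 0)|apply: (H 1)].
Qed.

Lemma borel_of_basic T (D : nat -> set T) n : borel_of D (D n).
Proof. by apply: sub_sigma_algebra; exists n. Qed.

Lemma exists_branch (P : seq nat -> Prop) : P [::] ->
  (forall s, P s -> exists v, P (rcons s v)) ->
  exists u : nat -> nat, forall k, P (mkseq u k).
Proof.
move=> P0 PS.
have /choice[h Hh] : forall s, exists v, P s -> P (rcons s v).
  move=> s; case: (pselect (P s)) => [/PS[v Pv]|nP]; first by exists v.
  by exists 0.
pose g k := iter k (fun s => rcons s (h s)) [::].
exists (h \o g) => k.
have -> : mkseq (h \o g) k = g k.
  by elim: k => // k IH; rewrite mkseqS IH.
by elim: k => //= k /Hh.
Qed.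

Section novikov.
Variables (T : Type) (D : nat -> set T).
Hypothesis sepD : separating D.

Definition borel_separated (A : nat -> set T) :=
  exists B : nat -> set T,
    [/\ forall i, borel_of D (B i), forall i, A i `<=` B i & \bigcap_i B i = set0].

(** A family is separated as soon as each family obtained by replacing [A i0]
    with one of countably many pieces covering it is: take the union of the
    separating sets at [i0], and their intersection elsewhere. *)
Lemma borel_separated_piece (A : nat -> set T) (A' : nat -> nat -> set T) i0 :
  A i0 `<=` \bigcup_v A' v i0 ->
  (forall i v, i != i0 -> A i `<=` A' v i) ->
  (forall v, borel_separated (A' v)) -> borel_separated A.
Proof.
move=> Ai0 Ai /choice[B HB].
exists (fun i => if i == i0 then \bigcup_v B v i else \bigcap_v B v i); split.
- move=> i; case: ifP => _.
    by apply: borel_of_bigcup => v; case: (HB v).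
  by apply: borel_of_bigcap => v; case: (HB v).
- move=> i; case: eqVneq => [->|ii0].
    by move=> x /Ai0[v _ A'x]; exists v => //; have [_ H _] := HB v; exact: H.
  by move=> x Ax v _; have [_ H _] := HB v; apply: H; exact: Ai ii0 x Ax.
- rewrite -subset0 => x Hx.
  have := Hx i0 I; rewrite eqxx => -[v _ Bx].
  have [_ _ <-] := HB v; move=> i _; have := Hx i I.
  by case: eqVneq => [-> //|_]; apply.
Qed.

(** Otherwise fix, one after the other, the coordinates of the codes of all the
    sets, keeping the family inseparable at each stage. The limit codes then
    name one and the same point: if [D n] told apart the points named at [i]
    and [j], it would contain the [i]-th piece and avoid the [j]-th piece from
    some stage on, and so separate the family. This point lies in all the
    sets. *)
Theorem novikov_separation (A : nat -> set T) :
  (forall i, analytic D (A i)) -> \bigcap_i A i = set0 -> borel_separated A.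
Proof.
move=> aA A0; apply: contrapT => nsep.
have /choice[Cf HCf] : forall i, exists Cf : set (nat -> nat) * ((nat -> nat) -> T),
    [/\ closed_code Cf.1, locally_decided D Cf.1 Cf.2 & Cf.2 @` Cf.1 = A i].
  by move=> i; have [C [f H]] := aA i; exists (C, f).
(* [piece s i] is the part of [A i] whose interleaved codes start with [s] *)
pose cyl (s : seq nat) t := forall k, k < size s -> t k = nth 0 s k.
pose piece s i := [set (Cf i).2 (slice i t) | t in [set t | cyl s t /\ (Cf i).1 (slice i t)]].
have [u Hu] : exists u : nat -> nat, forall k, ~ borel_separated (piece (mkseq u k)).
  apply: (@exists_branch (fun s => ~ borel_separated (piece s))).
    apply: contra_not nsep => -[B [mB AB B0]]; exists B; split => // i.
    apply: subset_trans (AB i); have [_ _ <-] := HCf i; move=> _ [u Cu <-].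
    pose t m := if (unpickle m : option (nat * nat)) is Some p then u p.2 else 0.
    have tE : slice i t = u by apply/funext => n; rewrite /slice /t pickleK.
    by exists t; rewrite /= ?tE.
  move=> s; apply: contra_notP => /forallNP Hs.
  (* only the set that owns the next coordinate is cut *)
  pose i0 := (odflt (0, 0) (unpickle (size s) : option (nat * nat))).1.
  apply: (@borel_separated_piece _ (fun v => piece (rcons s v)) i0).
  - move=> _ [t [cst Ct] <-]; exists (t (size s)) => //; exists t => //; split => //.
    move=> k; rewrite size_rcons ltnS leq_eqVlt nth_rcons => /orP[/eqP->|ks].
      by rewrite ltnn eqxx.
    by rewrite ks; exact: cst.
  - move=> i v ii0 _ [t [cst Ct] <-].
    pose t' k := if k == size s then v else t k.
    have tE : slice i t' = slice i t.
      apply/funext => n; rewrite /slice /t'; case: eqP => // e.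
      by move: ii0; rewrite /i0 -e pickleK /= eqxx.
    exists t'; rewrite /= ?tE//; split => // k.
    rewrite size_rcons ltnS nth_rcons /t' => ks; case: ltnP => [ks'|ks'].
      by rewrite ltn_eqF//; exact: cst.
    by rewrite [k == _]eqn_leq ks ks'.
  - by move=> v; apply: contrapT; exact: Hs.
have cylE (s : seq nat) k t (i : nat) : (forall n : nat, n \in s -> pickle (i, n) < k) ->
    cyl (mkseq u k) t -> agree s (slice i t) (slice i u).
  move=> sk ct n /sk nk; have := ct (pickle (i, n)).
  by rewrite size_mkseq nth_mkseq// /slice => ->.
have bound (s : seq nat) (i : nat) : exists k, forall n : nat, n \in s -> pickle (i, n) < k.
  exists (\max_(n <- s) pickle (i, n)).+1 => n ns.
  by rewrite ltnS (big_rem n)//= leq_maxl.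
have Cu i : (Cf i).1 (slice i u).
  have [clC _ _] := HCf i; apply: clC => s; have [k Hk] := bound s i.
  have [[_ [t [ct Ct] _]]|Hem] := pselect (piece (mkseq u k) i !=set0).
    by exists (slice i t) => //; exact: cylE Hk ct.
  (* an empty piece is separated from anything *)
  exfalso; apply: (Hu k); exists (fun j => if j == i then set0 else setT); split.
  - by move=> j; case: ifP => _; [exact: borel_of0|exact: borel_ofT].
  - by move=> j; case: eqP => [->|_] x // Hx; apply: Hem; exists x.
  - by rewrite -subset0 => x /(_ i I); rewrite eqxx.
pose y i := (Cf i).2 (slice i u).
have near_y i n : exists k, forall k' x, k <= k' -> piece (mkseq u k') i x ->
    (D n x <-> D n (y i)).
  have [_ dC _] := HCf i; have [s Hs] := dC _ n (Cu i).
  have [k Hk] := bound s i; exists k => k' _ kk' [t [ct Ct] <-].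
  by apply: Hs => //; apply: cylE ct => m /Hk/leq_trans; exact.
have sep_pieces i j n : D n (y i) -> ~ D n (y j) -> False.
  move=> Di Dj; have [k Hk] := near_y i n; have [l Hl] := near_y j n.
  apply: (Hu (maxn k l)).
  exists (fun m => if m == i then D n else if m == j then ~` D n else setT); split.
  - move=> m; case: ifP => _; first exact: borel_of_basic.
    case: ifP => _; first by apply: borel_ofC; exact: borel_of_basic.
    exact: borel_ofT.
  - move=> m; case: eqP => [-> x px|_].
      by apply/(Hk _ x (leq_maxl _ _) px).
    by case: eqP => [-> x px|_ //]; move=> /(Hl _ x (leq_maxr _ _) px).
  - rewrite -subset0 => x Hx; have := Hx i I; have := Hx j I; rewrite !eqxx.
    by case: eqP => [ji|//]; move: Dj; rewrite ji.
suff : (\bigcap_i A i) (y 0) by rewrite A0.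
move=> i _; have [_ _ <-] := HCf i; exists (slice i u) => //; apply: sepD => n.
by split => H; apply: contrapT; [exact: (sep_pieces i 0 n)|exact: (sep_pieces 0 i n)].
Qed.

Corollary lusin_separation (A B : set T) : analytic D A -> analytic D B ->
  A `&` B = set0 -> exists E, [/\ borel_of D E, A `<=` E & E `&` B = set0].
Proof.
move=> aA aB AB0.
have [| |E [mE AE E0]] := @novikov_separation (fun i => if i is 0 then A else B).
- by case.
- by rewrite -subset0 -AB0 => x Hx; split; [exact: (Hx 0)|exact: (Hx 1)].
exists (E 0); split => //; first exact: (AE 0).
rewrite -subset0 -E0 => x [Ex Bx] [|i] _ //; exact: (AE i.+1).
Qed.

End novikov.

(** * Borel sets with open sections *)

Section open_sections.
Variables (X Y : Type) (DX : nat -> set X) (DY V : nat -> set Y).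
Hypotheses (sepX : separating DX) (sepY : separating DY).
Hypotheses (aX : analytic DX setT) (aY : analytic DY setT).
Hypothesis bV : forall n, borel_of DY (V n).

Let D := prod_basis DX DY.
Let aXY : analytic D setT.
Proof. by rewrite -setXTT; exact: analyticX. Qed.

(** The theorem of Kunugui and Novikov, for the complement of [F]. The points
    of the complement that [V n] does not witness form an analytic set, since
    [V n] fails for x when it meets the section of [F]; Novikov separation gives
    a Borel part of the complement witnessed by each [V n], and its projection
    is separated from the states whose section meets [V n]. *)
Theorem borel_open_sections (F : set (X * Y)) :
  analytic D F -> analytic D (~` F) ->
  (forall x y, ~ F (x, y) ->
     exists2 n, V n y & forall y', V n y' -> ~ F (x, y')) ->
  exists B : nat -> set X, [/\ forall n, borel_of DX (B n),
    forall x n y, B n x -> V n y -> ~ F (x, y) &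
    forall x y, ~ F (x, y) -> exists2 n, B n x & V n y].
Proof.
move=> aF aG openG.
have sepD : separating D by exact: separating_prod.
have aV n : analytic DY (V n) by exact: analytic_borel.
have aVC n : analytic DY (~` V n) by by apply: analytic_borel => //; exact: borel_ofC.
pose meets n := fst @` (F `&` setT `*` V n).
have aM n : analytic DX (meets n).
  by apply: (@analytic_fst _ _ _ DY); apply: analyticI => //; exact: analyticX.
pose A n := ~` F `&` ((setT `*` ~` V n) `|` (meets n `*` setT)).
have aA n : analytic D (A n).
  by apply: analyticI => //; apply: analyticU; exact: analyticX.
have A0 : \bigcap_n A n = set0.
  rewrite -subset0 => -[x y] Axy; have [nF _] := Axy 0 I.
  have [n Vy Hn] := openG x y nF.
  have [_ [[_ /(_ Vy)//]|[[[x' y'] [Fx' [_ Vy']] /= xx'] _]]] := Axy n I.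
  by apply: (Hn y' Vy'); rewrite -xx'.
have [C [bC AC C0]] := novikov_separation sepD aA A0.
have /choice[B HB] : forall n, exists B, [/\ borel_of DX B,
    fst @` (~` F `&` ~` C n) `<=` B & B `&` meets n = set0].
  move=> n; apply: lusin_separation => //.
    apply: (@analytic_fst _ _ _ DY); apply: analyticI => //.
    by apply: analytic_borel => //; exact: borel_ofC.
  rewrite -subset0 => x [[[x1 y1] [nF nC] /= x1x] mx]; apply: nC; apply: AC.
  by split => //; right; split => //=; rewrite x1x.
exists B; split.
- by move=> n; case: (HB n).
- move=> x n y Bx Vy Fxy; have [_ _] := HB n; rewrite -subset0; apply.
  by split; [exact: Bx|exists (x, y)].
- move=> x y nF.
  have [n nC] : exists n, ~ C n (x, y).
    by apply/existsNP => H; have : (\bigcap_n C n) (x, y) by []; rewrite C0.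
  exists n; first by have [_ sB _] := HB n; apply: sB; exists (x, y).
  by apply: contrapT => nV; apply: nC; apply: AC; split => //; left.
Qed.

End open_sections.

Local Open Scope ring_scope.

(** * Projection of Borel sets with compact sections *)

Definition open_base (T : topologicalType) (V : nat -> set T) :=
  (forall n, open (V n)) /\
  forall O x, open O -> O x -> exists2 n, V n x & V n `<=` O.

Lemma open_borel_of (T : topologicalType) (V : nat -> set T) O :
  open_base V -> open O -> borel_of V O.
Proof.
move=> [oV baseV] oO.
rewrite (_ : O = \bigcup_n (if `[< V n `<=` O >] then V n else set0)).
  by apply: borel_of_bigcup => n; case: ifP => _;
    [exact: borel_of_basic|exact: borel_of0].
apply/seteqP; split=> [x Ox|x [n _]].
  have [n Vx VO] := baseV _ _ oO Ox; exists n => //.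
  by move/asboolP: VO => ->.
by case: ifP => // /asboolP; apply.
Qed.

Lemma open_base_separating (T : topologicalType) (V : nat -> set T) :
  hausdorff_space T -> open_base V -> separating V.
Proof.
move=> hT [oV baseV] x y xy; apply: hT => A B.
rewrite !nbhsE => -[A' [oA' A'x] sA] [B' [oB' B'y] sB].
have [n Vx VA] := baseV _ _ oA' A'x.
by exists y; split; [apply/sA/VA/xy|exact/sB].
Qed.

Lemma ultrafilter_bigcup_ord T (U : set_system T) (A : nat -> set T) m :
  UltraFilter U -> U (\bigcup_(i < m) A i) -> exists i, U (A i).
Proof.
move=> UU; elim: m => [|m IH].
  by rewrite bigcup_mkord big_ord0 => /filter_not_empty.
rewrite bigcup_mkord big_ord_recr /= -bigcup_mkord => UAm.
have [|UC] := in_ultra_setVsetC (A m) UU; first by exists m.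
apply: IH; apply: filterS (filterI UAm UC) => x [[//|Ax] nAx].
by exfalso; exact: nAx.
Qed.

Lemma exists_invn_lt (R : realType) (e : R) : 0 < e -> exists n, n.+1%:R^-1 < e.
Proof.
move=> e0; exists (Num.trunc e^-1).
rewrite invf_plt ?posrE ?ltr0n//.
by rewrite truncnS_gt.
Qed.

Lemma metric_ball_open (R : realType) (P : metricType R) (a : P) (e : R) :
  open (ball a e).
Proof.
rewrite openE => x /= axe; apply/nbhs_ballP; exists (e - mdist a x) => /=.
  by move: axe; rewrite ballEmdist /= subr_gt0.
move=> y; rewrite !ballEmdist /= => xy.
by rewrite (le_lt_trans (metric_triangle a x y))// -ltrBrDl.
Qed.

Lemma compact_increasing_cover (T : topologicalType) (A : set T)
    (O : nat -> set T) : compact A -> (forall n, open (O n)) ->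
  (forall m n, (m <= n)%N -> O m `<=` O n) -> A `<=` \bigcup_n O n ->
  exists n, A `<=` O n.
Proof.
move=> cA oO incO AO; apply: contrapT => /forallNP nAO.
pose F := filter_from [set: nat] (fun n => A `\` O n).
have FF : ProperFilter F.
  apply: filter_from_proper.
    apply: filter_from_filter; first by exists 0%N.
    move=> m n _ _; exists (maxn m n) => // x [Ax nx]; split; split => //.
      by apply: contra_not nx; apply: incO; exact: leq_maxl.
    by apply: contra_not nx; apply: incO; exact: leq_maxr.
  move=> n _; have /existsNP[x /not_implyP[Ax nOx]] := nAO n.
  by exists x.
have [|p [Ap clp]] := cA F FF; first by exists 0%N => // x [].
have [n _ Op] := AO p Ap.
have FAn : F (A `\` O n) by exists n.
by have [q [[_ nq] /nq]] := clp _ _ FAn (open_nbhs_nbhs (conj (oO n) Op)).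
Qed.

Section compact_sections.
Variables (R : realType) (X : Type) (DX : nat -> set X) (P : metricType R).
Variables (V : nat -> set P) (d : nat -> P).
Hypothesis complete : forall F : set_system P, ProperFilter F -> cauchy F ->
  exists p : P, F --> p.
Hypotheses (sepX : separating DX) (aX : analytic DX setT).
Hypotheses (baseV : open_base V) (aP : analytic V setT).
Hypothesis dense_d : forall (p : P) (e : R), 0 < e -> exists i, ball (d i) e p.

Let W k m : set P := \bigcup_(i < m) ball (d i) k.+1%:R^-1.

Let W_open k m : open (W k m).
Proof. by apply: bigcup_open => i _; exact: metric_ball_open. Qed.

(** An ultrafilter finer than the tails selects one ball of each radius, hence
    is Cauchy along [z]. *)
Let cluster_W (m : nat -> nat) (z : nat -> P) :
  (forall k j, (j < k)%N -> W j (m j) (z k)) ->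
  exists p, forall O, open O -> O p -> forall n, exists2 k, (n <= k)%N & O (z k).
Proof.
move=> zW; have [U [UU sU]] := ultraFilterLemma (@eventually_filter).
have [|p Fp] := @complete (z @ U).
  apply: cauchy_exP => e e0; have [j je] := exists_invn_lt e0.
  have : U (\bigcup_(i < m j) (z @^-1` ball (d i) j.+1%:R^-1)).
    apply: sU; exists j.+1 => // k /= jk; have [i im zi] := zW k j jk.
    by exists i.
  move=> /ultrafilter_bigcup_ord[i Ui]; exists (d i).
  by apply: filterS Ui => k /=; apply: le_ball; exact: ltW.
exists p => O oO Op n.
have UO : U (z @^-1` O) by apply: Fp; exact: open_nbhs_nbhs.
have Un : U [set k | (n <= k)%N] by apply: sU; exists n.
by have [k [? ?]] := filter_ex (filterI UO Un); exists k.
Qed.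

(** By total boundedness the section at x lies in some [W k m] for each k, and
    Novikov separation chooses such an m in a Borel way. If the section at x is
    empty, the [V n] with x in [B n], given by [borel_open_sections], cover [P],
    and by completeness finitely many of them already cover the intersection of
    finitely many of the chosen [W k m]. Conversely such a finite cover forces
    the section to be empty, and there are countably many possible covers. *)
Theorem borel_projection_compact_sections (F : set (X * P)) :
  analytic (prod_basis DX V) F -> analytic (prod_basis DX V) (~` F) ->
  (forall x, compact [set p | F (x, p)]) -> borel_of DX (fst @` F).
Proof.
move=> aF aG Fcompact.
have hP : hausdorff_space P by exact: metric_hausdorff.
have sepV : separating V by exact: open_base_separating.
have sepD : separating (prod_basis DX V) by exact: separating_prod.
have [B [bB BF BG]] : exists B : nat -> set X, [/\ forall n, borel_of DX (B n),
    forall x n y, B n x -> V n y -> ~ F (x, y) &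
    forall x y, ~ F (x, y) -> exists2 n, B n x & V n y].
  apply: (@borel_open_sections _ _ _ V) => //.
    by move=> n; exact: borel_of_basic.
  move=> x y nF.
  have oF : open (~` [set p | F (x, p)]).
    by apply: closed_openC; exact: compact_closed.
  have [n Vy VF] := baseV.2 _ _ oF nF.
  by exists n => // y' /VF.
(* the states whose section is not covered by the first m balls *)
pose esc k m := fst @` (F `&` setT `*` (~` W k m)).
have /choice[C HC] : forall k, exists C : nat -> set X,
    [/\ forall m, borel_of DX (C m), forall m, esc k m `<=` C m & \bigcap_m C m = set0].
  move=> k; apply: novikov_separation => //.
    move=> m; apply: (@analytic_fst _ _ _ V); apply: analyticI => //.
    apply: analyticX => //; apply: analytic_borel => //.
    by apply: borel_ofC; exact: open_borel_of.
  rewrite -subset0 => x Hx.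
  have [| | | |m Hm] := @compact_increasing_cover _ [set p | F (x, p)] (W k).
  - exact: Fcompact.
  - by move=> m; exact: W_open.
  - by move=> m n mn p [i /= im pi]; exists i => //=; exact: leq_trans mn.
  - move=> p _; have [|i pi] := dense_d p (e := k.+1%:R^-1); first by rewrite invr_gt0.
    by exists i.+1 => //; exists i => /=.
  - have [[x' p] [Fp [_ nW]] /= xx'] := Hx m I.
    by rewrite xx' in Fp; apply: nW; exact: Hm.
rewrite -[X in borel_of _ X]setCK; apply: borel_ofC.
pose covers (l s : seq nat) :=
  `[< forall p, (forall j, (j < size l)%N -> W j (nth 0%N l j) p) ->
        exists2 n, n \in s & V n p >].
pose good (l s : seq nat) :=
  \bigcap_j (if (j < size l)%N then ~` C j (nth 0%N l j) else setT) `&`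
  \bigcap_n (if n \in s then B n else setT).
rewrite (_ : ~` _ = \bigcup_i (if (unpickle i : option (seq nat * seq nat)) is Some ls
    then (if covers ls.1 ls.2 then good ls.1 ls.2 else set0) else set0)).
  apply: borel_of_bigcup => i; case: unpickle => [[l s]|]; last exact: borel_of0.
  case: ifP => _; last exact: borel_of0.
  apply: borel_ofI => /=.
    apply: borel_of_bigcap => j; case: ifP => _; last exact: borel_ofT.
    by apply: borel_ofC; have [] := HC j.
  by apply: borel_of_bigcap => n; case: ifP => _; [exact: bB|exact: borel_ofT].
apply/seteqP; split=> x.
- move=> nFx.
  have Fx0 p : ~ F (x, p) by move=> Fp; apply: nFx; exists (x, p).
  have /choice[m Hm] : forall k, exists m, ~ C k m x.
    move=> k; apply/existsNP => H; have [_ _] := HC k; rewrite -subset0.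
    by apply => m _; exact: H.
  pose s k := [seq n <- iota 0 k | `[< B n x >]].
  suff [k Hk] : exists k, covers (mkseq m k) (s k).
    exists (pickle (mkseq m k, s k)) => //; rewrite pickleK /= Hk; split.
      move=> j _; rewrite size_mkseq; case: ifP => // jk.
      by rewrite nth_mkseq//; exact: Hm.
    by move=> n _; case: ifP => //; rewrite mem_filter => /andP[/asboolP].
  apply: contrapT => /forallNP Hn.
  have /choice[z Hz] : forall k, exists p, (forall j, (j < k)%N -> W j (m j) p) /\
      forall n, (n < k)%N -> B n x -> ~ V n p.
    move=> k; have /asboolPn/existsNP[p /not_implyP[pW pV]] : ~~ covers (mkseq m k) (s k).
      exact/negP/Hn.
    exists p; split => [j jk|n nk Bn Vn].
      by have := pW j; rewrite size_mkseq nth_mkseq//; exact.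
    apply: pV; exists n => //; rewrite mem_filter mem_iota add0n nk !andbT.
    exact/asboolP.
  have [k j jk|p Hp] := @cluster_W m z; first by have [H _] := Hz k; exact: H.
  have [n Bn Vn] := BG x p (Fx0 p).
  have [k nk Vk] := Hp _ (baseV.1 n) Vn n.+1.
  by have [_ H] := Hz k; exact: (H n nk Bn Vk).
- move=> [i _]; case: unpickle => [[l s]|//] /=; case: ifP => // /asboolP cov.
  move=> [xC xB] [[x' p] Fp /= xx']; rewrite xx' in Fp.
  have [|n ns Vn] := cov p.
    move=> j jl; have := xC j I; rewrite jl => nC; apply: contrapT => nW.
    by apply: nC; have [_ sub _] := HC j; apply: sub; exists (x, p).
  by have := xB n I; rewrite ns => Bn; exact: (BF x n p).
Qed.

End compact_sections.

(** * Polish spaces and Borel spaces *)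

Definition rational_ball (R : realType) (P : metricType R) (d : nat -> P) n :=
  let ik := odflt (0, 0)%N (unpickle n : option (nat * nat)) in
  ball (d ik.1) (ik.2.+1%:R^-1 : R).

Lemma invSn_gt0 (R : realType) n : 0 < n.+1%:R^-1 :> R.
Proof. by rewrite invr_gt0. Qed.

Section polish.
Variables (R : realType) (P : metricType R) (d : nat -> P).
Hypothesis complete : forall F : set_system P, ProperFilter F -> cauchy F ->
  exists p : P, F --> p.
Hypothesis dense_d : forall (p : P) (e : R), 0 < e -> exists i, ball (d i) e p.

Let V := rational_ball d.

Lemma rational_ball_base : open_base V.
Proof.
split; first by move=> n; exact: metric_ball_open.
move=> O x oO Ox.
have /nbhs_ballP[e /= e0 xO] := open_nbhs_nbhs (conj oO Ox).
have [k ke] := exists_invn_lt (divr_gt0 e0 (ltr0n _ 2)).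
have [i ix] := dense_d x (invSn_gt0 R k).
exists (pickle (i, k)); rewrite /V /rational_ball pickleK //= => y iy.
apply: xO; rewrite (splitr e); apply: (@ball_triangle _ _ (d i)).
  by apply/ball_sym; exact: le_ball (ltW ke) _ ix.
exact: le_ball (ltW ke) _ iy.
Qed.

(** Even digits name approximations of the point; odd digits decide membership
    in the basic balls, a positive answer carrying a margin. Every clause is a
    closed condition on the point, so completeness makes the set of codes
    closed. *)
Let named (u : nat -> nat) (p : P) := forall n,
  mdist (d (u n.*2)) p <= n.+1%:R^-1 /\
  if u n.*2.+1 is j.+1 then
    let ik := odflt (0, 0)%N (unpickle n : option (nat * nat)) in
    mdist (d ik.1) p <= ik.2.+1%:R^-1 - j.+1%:R^-1
  else ~ V n p.

Let named_inj u p p' : named u p -> named u p' -> p = p'.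
Proof.
move=> Hp Hp'; apply: mdist_positivity; apply/eqP; rewrite eq_le mdist_ge0 andbT.
apply/ler_addgt0Pl => e e0; rewrite addr0.
have [k ke] := exists_invn_lt (divr_gt0 e0 (ltr0n _ 2)).
have [Hk _] := Hp k; have [Hk' _] := Hp' k.
rewrite (le_trans (metric_triangle p (d (u k.*2)) p'))// (splitr e) lerD//.
  by rewrite metric_sym (le_trans Hk)// ltW.
by rewrite (le_trans Hk')// ltW.
Qed.

Let named_V u p n : named u p -> (V n p <-> u n.*2.+1 <> 0%N).
Proof.
move=> /(_ n)[_]; case: (u n.*2.+1) => [|j] H; first by split.
split => // _; rewrite /V /rational_ball ballEmdist /=.
by rewrite (le_lt_trans H)// ltrBlDr ltrDl invSn_gt0.
Qed.

Let mdist_cvg_le (F : set_system P) (p a : P) (r : R) : ProperFilter F ->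
  F --> p -> F [set x | mdist a x <= r] -> mdist a p <= r.
Proof.
move=> FF Fp Fr; apply/ler_addgt0Pl => e e0.
have Fe : F (ball p e) by apply: Fp; exact: nbhsx_ballx.
have [x [/= xr]] := filter_ex (filterI Fr Fe).
rewrite ballEmdist /= => px; rewrite addrC.
by rewrite (le_trans (metric_triangle a x p))// lerD// metric_sym ltW.
Qed.

Lemma polish_analytic : analytic V setT.
Proof.
have /choice[f Hf] : forall u, exists p, (exists p, named u p) -> named u p.
  by move=> u; case: (pselect (exists p, named u p)) => [[p Hp]|H];
    [exists p|exists (d 0%N)].
exists [set u | exists p, named u p], f; split.
- move=> u Hu.
  have /choice[q Hq] : forall N, exists p, exists2 t, named t p & agree (iota 0 N) t u.
    by move=> N; have [t [p tp] tu] := Hu (iota 0 N); exists p, t.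
  have Hqu N n : (n.*2 < N)%N -> mdist (d (u n.*2)) (q N) <= n.+1%:R^-1.
    move=> nN; have [t tq tu] := Hq N; have [+ _] := tq n.
    by rewrite tu// mem_iota add0n.
  have [|p qp] := @complete (q @ \oo).
    apply: cauchy_exP => e e0; have [k ke] := exists_invn_lt e0.
    exists (d (u k.*2)); exists k.*2.+1 => // N /= kN.
    by rewrite ballEmdist /= (le_lt_trans (Hqu _ _ kN)).
  exists p => n; split.
    by apply: (@mdist_cvg_le (q @ \oo) p _ _ _ qp); exists n.*2.+1 => // N /= nN; exact: Hqu.
  case E : (u n.*2.+1) => [|j].
    move=> Vp; have : (q @ \oo) (V n).
      by apply: qp; apply: open_nbhs_nbhs; split => //; exact: rational_ball_base.1.
    move=> [N0 _ HN0]; pose N := maxn N0 n.*2.+2.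
    have [t tq tu] := Hq N.
    have : V n (q N) by apply: HN0; rewrite /= leq_maxl.
    move/(named_V n tq); apply; rewrite tu// mem_iota add0n /=.
    exact: leq_maxr.
  apply: (@mdist_cvg_le (q @ \oo) p _ _ _ qp); exists n.*2.+2 => // N /= nN.
  have [t tq tu] := Hq N; have [_] := tq n.
  by rewrite tu ?E// mem_iota add0n.
- move=> u n Cu; exists [:: n.*2.+1] => t Ct tu.
  have := named_V n (Hf _ Ct); have := named_V n (Hf _ Cu).
  by rewrite tu ?inE//; tauto.
- apply/seteqP; split=> // p _.
  have /choice[a Ha] : forall n, exists i, mdist (d i) p <= n.+1%:R^-1.
    move=> n; have [i] := dense_d p (invSn_gt0 R n); rewrite ballEmdist /= => ip.
    by exists i; exact: ltW.
  have /choice[b Hb] : forall n, exists m, if m is j.+1 then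
      let ik := odflt (0, 0)%N (unpickle n : option (nat * nat)) in
      mdist (d ik.1) p <= ik.2.+1%:R^-1 - j.+1%:R^-1
    else ~ V n p.
    move=> n; have [|nV] := pselect (V n p); last by exists 0%N.
    rewrite /V /rational_ball ballEmdist /= -subr_gt0 => /exists_invn_lt[j ij].
    by exists j.+1 => /=; rewrite lerBrDr -lerBrDl ltW.
  pose u k := if odd k then b k./2 else a k./2.
  have up : named u p.
    move=> n; rewrite /u /= odd_double /= uphalf_double doubleK.
    by split; [exact: Ha|exact: Hb].
  exists u; first by exists p.
  by apply: (@named_inj u) => //; apply: Hf; exists p.
Qed.

End polish.

Lemma dense_sequence (R : realType) (P : metricType R) (D : set P) (p0 : P) :
  countable D -> dense D ->
  exists d : nat -> P, forall p (e : R), 0 < e -> exists i, ball (d i) e p.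
Proof.
move=> /countable_injP[f finj] denseD.
have /choice[d Hd] : forall n, exists q, forall p, D p -> f p = n -> q = p.
  move=> n; have [[q [Dq fq]]|H] := pselect (exists q, D q /\ f q = n).
    by exists q => p Dp fp; apply: finj; rewrite ?inE// fq fp.
  by exists p0 => p Dp fp; exfalso; apply: H; exists p.
exists d => p e e0.
have [|q [pq Dq]] := denseD (ball p e) _ (metric_ball_open p e).
  by exists p; exact: (ballxx _ e0).
by exists (f q); rewrite (Hd _ q Dq erefl); exact: ball_sym.
Qed.

Lemma borel_of_open (T : topologicalType) (V : nat -> set T) E :
  open_base V -> <<s open >> E -> borel_of V E.
Proof.
move=> baseV; apply: smallest_sub E; first exact: smallest_sigma_algebra.
by move=> O oO; exact: open_borel_of.
Qed.

Lemma borel_of_preimage T T' (D : nat -> set T) (D' : nat -> set T')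
    (h : T -> T') E :
  (forall n, borel_of D (h @^-1` D' n)) -> borel_of D' E -> borel_of D (h @^-1` E).
Proof.
move=> hD; suff : borel_of D' `<=` [set E | borel_of D (h @^-1` E)] by apply.
apply: smallest_sub; last by move=> _ [n _ <-]; exact: hD.
split.
- by rewrite /= preimage_set0; exact: borel_of0.
- by move=> B bB /=; rewrite setTD preimage_setC; exact: borel_ofC.
- by move=> F bF /=; rewrite preimage_bigcup; exact: borel_of_bigcup.
Qed.

Lemma borel_space_embedding (R : realType) (S : ptopologicalType) :
  borel_space R S -> exists (P : metricType R) (d : nat -> P) (j : S -> P) (g : P -> S),
    [/\ forall F : set_system P, ProperFilter F -> cauchy F -> exists p : P, F --> p,
        forall p (e : R), 0 < e -> exists i, ball (d i) e p,
        cancel j g /\ continuous j,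
        borel_of (rational_ball d) (range j)
      & open_base (fun n => j @^-1` rational_ball d n)].
Proof.
move=> [P [B [complete [D cD denseD] bB [f [g [fK gK cf cg]]]]]].
pose j : S -> P := fun x => \val (f x).
have [d Hd] := dense_sequence (j point) cD denseD.
have baseV := rational_ball_base Hd.
have vP x : B (j x) by have := valP (f x); rewrite inE.
pose h (p : P) : S := if pselect (B p) is left Bp then g (exist _ p (mem_set Bp)) else point.
exists P, d, j, h; split => //.
- split.
    move=> x; rewrite /h; case: pselect => [Bp|/(_ (vP x))//].
    by rewrite -[RHS]fK; congr g; apply: val_inj.
  move=> x; apply: (@continuous_comp _ _ _ f (fun y : set_type B => \val y)).
    exact: cf.
  exact: initial_continuous.
- rewrite (_ : range j = B); first exact: borel_of_open.
  apply/seteqP; split=> [_ [x _ <-]//|p Bp].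
  exists (g (exist _ p (mem_set Bp))) => //.
  by rewrite /j gK.
- split.
    move=> n; apply: open_comp; last exact: baseV.1.
    move=> x _; apply: (@continuous_comp _ _ _ f (fun y : set_type B => \val y)).
      exact: cf.
    exact: initial_continuous.
  move=> O x oO Ox.
  have : open (g @^-1` O) by apply: open_comp => // y _; exact: cg.
  move=> [W oW WE].
  have [|n Vx VW] := baseV.2 W (j x) oW.
    have : (g @^-1` O) (f x) by rewrite /= fK.
    by rewrite -WE.
  exists n => // y Vy.
  have : (g @^-1` O) (f y) by rewrite -WE; exact: VW.
  by rewrite /= fK.
Qed.

Lemma pullback_standard (R : realType) (P : metricType R) (d : nat -> P)
    (S : ptopologicalType) (j : S -> P) (g : P -> S) :
  (forall F : set_system P, ProperFilter F -> cauchy F -> exists p : P, F --> p) ->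
  (forall p (e : R), 0 < e -> exists i, ball (d i) e p) ->
  cancel j g -> borel_of (rational_ball d) (range j) ->
  separating (fun n => j @^-1` rational_ball d n) /\
  analytic (fun n => j @^-1` rational_ball d n) setT.
Proof.
move=> complete Hd jK bj.
have sepV : separating (rational_ball d).
  by apply: open_base_separating (rational_ball_base Hd); exact: metric_hausdorff.
split; first by move=> x y xy; apply: (can_inj jK); apply: sepV.
rewrite (_ : setT = g @` range j).
  apply: analytic_image (analytic_borel sepV (polish_analytic complete Hd) bj) => n.
  by exists n => _ [x _ <-] /=; rewrite jK.
by apply/seteqP; split=> // x _; exists (j x) => //; exists x.
Qed.

Lemma borel_space_standard (R : realType) (S : ptopologicalType) :
  borel_space R S -> exists D : nat -> set S,
    [/\ open_base D, separating D & analytic D setT].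
Proof.
move=> /borel_space_embedding[P [d [j [g [complete Hd [jK cj] bj baseD]]]]].
have [sepD aD] := pullback_standard complete Hd jK bj.
by exists (fun n => j @^-1` rational_ball d n).
Qed.

(** * Infima over compact sections *)

Lemma borel_of_measurable_prod (S A : ptopologicalType) (DS : nat -> set S)
    (DA : nat -> set A) (F : set (borel S * borel A)) :
  open_base DS -> open_base DA -> measurable F -> borel_of (prod_basis DS DA) F.
Proof.
move=> baseS baseA; apply: smallest_sub F; first exact: smallest_sigma_algebra.
move=> F [[E mE <-]|[E mE <-]]; rewrite setTI.
  apply: (@borel_of_preimage _ _ _ DS) => [n|]; last exact: borel_of_open.
  by rewrite -(prod_basis_fst DS DA); exact: borel_of_basic.
apply: (@borel_of_preimage _ _ _ DA) => [n|]; last exact: borel_of_open.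
by rewrite -(prod_basis_snd DS DA); exact: borel_of_basic.
Qed.

(** The action space is embedded in a complete metric space, where the compact
    sections remain compact and the previous theorem applies. *)
Theorem measurable_projection_compact_sections (R : realType)
    (S A : ptopologicalType) (F : set (borel S * borel A)) :
  borel_space R S -> borel_space R A -> measurable F ->
  (forall x, compact ([set a | F (x, a)] : set A)) ->
  measurable (fst @` F : set (borel S)).
Proof.
move=> /borel_space_standard[DS [baseS sepS aS]].
move=> /borel_space_embedding[P [d [j [g [complete Hd [jK cj] bj baseA]]]]] mF cF.
set V := rational_ball d in bj baseA; set DA := (fun n => _) in baseA.
have baseV : open_base V by exact: rational_ball_base.
have sepV : separating V.
  by apply: open_base_separating baseV; exact: metric_hausdorff.
have aP : analytic V setT by exact: polish_analytic.
have [sepA aA] : separating DA /\ analytic DA setT by exact: pullback_standard jK bj.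
have aSA : analytic (prod_basis DS DA) setT by rewrite -setXTT; exact: analyticX.
have sepSA : separating (prod_basis DS DA) by exact: separating_prod.
have bF := borel_of_measurable_prod baseS baseA mF.
pose h (xa : S * A) := (xa.1, j xa.2).
have ah E : borel_of (prod_basis DS DA) E -> analytic (prod_basis DS V) (h @` E).
  move=> bE; apply: analytic_image (analytic_borel sepSA aSA bE) => n.
  by exists n => xa _; rewrite /prod_basis; case: ifP.
have -> : fst @` F = fst @` (h @` F) by rewrite image_comp.
have sub : borel_of DS `<=` <<s open >>.
  apply: smallest_sub; first exact: smallest_sigma_algebra.
  by move=> _ [n _ <-]; apply: sub_sigma_algebra; exact: baseS.1.
apply: sub; apply: (@borel_projection_compact_sections R _ _ P V d) => //.
- exact: ah.
- rewrite (_ : ~` _ = (h @` ~` F) `|` setT `*` ~` range j).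
    apply: analyticU; first by apply: ah; exact: borel_ofC.
    apply: analyticX => //; apply: analytic_borel => //; exact: borel_ofC.
  apply/seteqP; split=> [[x p] nFp|xp [[xa nF <-]|[_ nj]]].
  + have [[a _ ja]|nj] := pselect (range j p); last by right.
    left; exists (x, a); last by rewrite /h /= ja.
    by move=> Fa; apply: nFp; exists (x, a) => //; rewrite /h /= ja.
  + move=> [[x a] Fxa [exa eja]]; apply: nF; move: exa eja Fxa.
    by case: xa => x' a' /= -> /(can_inj jK) ->.
  + by move=> [xa _ hxa]; apply: nj; exists xa.2 => //; rewrite -hxa.
- move=> x; rewrite (_ : [set p | _] = j @` [set a | F (x, a)]).
    by apply: continuous_compact (cF x); exact: continuous_subspaceT.
  apply/seteqP; split=> [p [[x' a] Fa [<- <-]]|_ [a Fa <-]]; first by exists a.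
  by exists (x, a).
Qed.

(** The infimum is below r when some sublevel set at height r - 1/(k+1) has a
    nonempty section, and lower semicontinuity makes these sections compact. *)
Theorem measurable_inf_compact_sections (R : realType)
    (S A : ptopologicalType) (adm : S -> set A) (h : S -> A -> \bar R) :
  borel_space R S -> borel_space R A -> measurable (state_action adm) ->
  (forall x, compact (adm x)) ->
  (forall x, lower_semicontinuous_on (adm x) (h x)) ->
  measurable_fun (state_action adm) (fun xa => h xa.1 xa.2) ->
  measurable_fun [set: borel S] (fun x => ereal_inf [set h x a | a in adm x]).
Proof.
move=> bS bA mK cadm lsch mh.
apply: (measurability _ (ErealGenInftyO.measurableE R)) => /= _ [_ [r ->] <-].
pose F k : set (borel S * borel A) :=
  state_action adm `&` (fun xa => h xa.1 xa.2) @^-1` [set y | y <= (r - k.+1%:R^-1)%:E]%E.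
rewrite setTI (_ : _ @^-1` _ = \bigcup_k (fst @` F k)).
  apply: bigcup_measurable => k _.
  apply: (measurable_projection_compact_sections bS bA).
    by apply: mh => //; rewrite -set_itvNyc; exact: emeasurable_itv.
  move=> x.
  have /lower_semicontinuousP/(_ (r - k.+1%:R^-1)) := lsch x.
  move=> /open_subspaceP[U oU UE].
  rewrite (_ : [set a | _] = adm x `&` ~` U).
    by apply: compact_closedI (cadm x) _; exact: open_closedC.
  apply/seteqP; split=> a [adma /=] ha; split => //.
    move=> Ua; have : (U `&` adm x) a by [].
    by rewrite UE => -[/=]; rewrite ltNge ha.
  rewrite /= leNgt; apply/negP => ha'; apply: ha.
  have : ([set y | ((r - k.+1%:R^-1)%:E < h x y)%E] `&` adm x) a by [].
  by rewrite -UE => -[].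
apply/seteqP; split=> x /=.
  rewrite in_itv /= => /ereal_inf_lt[_ [a adma <-]] har.
  have [k Hk] : exists k, (h x a <= (r - k.+1%:R^-1)%:E)%E.
    move: har; case: (h x a) => [s|//|_]; last by exists 0%N; rewrite leNye.
    rewrite lte_fin -subr_gt0 => /exists_invn_lt[k Hk]; exists k.
    by rewrite lee_fin lerBrDr -lerBrDl ltW.
  by exists k => //; exists (x, a).
move=> [k _ [[x' a] [adma /= ha] <-]]; rewrite in_itv /=.
apply: (@le_lt_trans _ _ (h x' a)); first by apply: ereal_inf_lbound; exists a.
by rewrite (le_lt_trans ha)// lte_fin ltrBlDr ltrDl invSn_gt0.
Qed.

(** * Charges nonnegative off one point *)

Section integral_facts.
Variables (d : measure_display) (T : measurableType d) (R : realType).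
Local Open Scope ereal_scope.

Lemma integrable_mscale (k : {nonneg R}) (m : {measure set T -> \bar R}) f :
  m.-integrable setT f -> (mscale k m).-integrable setT f.
Proof.
move=> /integrableP[mf fy]; apply/integrableP; split => //.
rewrite ge0_integral_mscale//; last exact: measurableT_comp.
by rewrite lte_mul_pinfty.
Qed.

Lemma integral_mscale (k : {nonneg R}) (m : {measure set T -> \bar R}) f :
  m.-integrable setT f -> \int[mscale k m]_y f y = k%:num%:E * \int[m]_y f y.
Proof.
move=> intf; have mf := measurable_int _ intf.
rewrite [in LHS]integralE [in RHS]integralE.
rewrite !ge0_integral_mscale//; [|exact: measurable_funeneg|exact: measurable_funepos].
rewrite -muleBr//; exact: integrable_add_def.
Qed.

Lemma integrable_dirac (x : T) (f : T -> R) :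
  measurable_fun setT f -> (\d_x : {measure set T -> \bar R}).-integrable setT (EFin \o f).
Proof.
move=> mf; apply/integrableP; split; first exact/measurable_EFinP.
rewrite integral_dirac//; last by apply: measurableT_comp => //; exact/measurable_EFinP.
by rewrite diracE in_setT mul1e ltry.
Qed.

End integral_facts.

Section one_point_charge.
Variables (d : measure_display) (T : measurableType d) (R : realType).
Variables (nu : {charge set T -> \bar R}) (x : T).
Hypothesis mx : measurable [set x].
Hypothesis nu_ge0 : forall U, measurable U -> (0 <= nu (U `\ x))%E.
Hypothesis nuT : nu setT = 0%E.

Let r := fine (- nu [set x]).

Lemma charge_singleton : nu [set x] = (- r)%:E.
Proof. by rewrite /r fineN opprK fineK// fin_num_measure. Qed.

Lemma exit_mass_ge0 : 0 <= r.
Proof.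
have := nu_ge0 measurableT; rewrite chargeD// nuT setTI add0e charge_singleton.
by rewrite -EFinN opprK lee_fin.
Qed.

Lemma charge_setI1 U : measurable U -> nu (U `&` [set x]) = (- (r%:E * \d_x U))%E.
Proof.
move=> mU; rewrite diracE; have [xU|xU] := pselect (U x).
  rewrite mem_set// (_ : _ `&` _ = [set x]); last by rewrite setIC; apply/setIidPl => y ->.
  by rewrite charge_singleton mule1.
rewrite memNset// (_ : _ `&` _ = set0); first by rewrite charge0 mule0 oppe0.
by rewrite -subset0 => y [Uy yx]; apply: xU; rewrite -yx.
Qed.

(** A subset of the negative part that misses x has both signs, hence vanishes:
    the negative part of the Jordan decomposition is [r] times the Dirac mass at
    x, and the positive part is the restriction to the complement of x. *)
Lemma charge_integral_one_point : exists m : {measure set T -> \bar R},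
  (forall U, measurable U -> m U = nu (U `\ x)) /\
  forall f : T -> R, measurable_fun setT f ->
    charge_integral nu (EFin \o f) = (\int[m]_y (f y)%:E - (r * f x)%:E)%E.
Proof.
rewrite /charge_integral; case: (cid (Hahn_decomposition nu)) => P exN.
case: (cid exN) => N nuPN.
have [[mP Ppos] [mN Nneg] PNT PN0] := nuPN.
have negE U : measurable U -> (nu (U `&` N) = nu (U `&` [set x]))%E.
  move=> mU.
  have mUN : measurable (U `&` N) by exact: measurableI.
  have -> : nu (U `&` N) = nu (U `&` N `&` [set x]).
    rewrite [LHS](chargeDI nu mUN mx) (_ : nu (_ `\` _) = 0%E) ?add0e//.
    apply/eqP; rewrite eq_le; apply/andP; split; last exact: nu_ge0.
    by apply: Nneg; [exact: measurableD|move=> y [[]]].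
  have mUx : measurable (U `&` [set x]) by exact: measurableI.
  rewrite (charge_partition nu mUx mP mN)// (_ : nu (_ `&` P) = 0%E).
    by rewrite add0e setIAC.
  apply/eqP; rewrite eq_le; apply/andP; split; last first.
    by apply: Ppos; [exact: measurableI|move=> y []].
  rewrite setIAC charge_setI1; last exact: measurableI.
  rewrite oppe_le0 mule_ge0// ?lee_fin ?exit_mass_ge0//.
have r0 := exit_mass_ge0.
exists (jordan_pos nuPN); split.
  move=> U mU; rewrite [LHS]jordan_posE cjordan_posE /crestr0 mem_set// /crestr.
  rewrite chargeD// -negE// [in RHS](charge_partition nu mU mP mN)//.
  by rewrite addeK// fin_num_measure//; exact: measurableI.
move=> f mf; congr (_ - _)%E.
rewrite (eq_measure_integral (mscale (NngNum r0) (\d_x : {measure set T -> \bar R}))).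
  rewrite integral_mscale ?integral_dirac ?diracE ?in_setT ?mul1e//.
  - exact/measurable_EFinP.
  - exact: integrable_dirac.
move=> U mU _; rewrite [LHS]jordan_negE cjordan_negE /crestr0 mem_set// /crestr.
by rewrite negE// charge_setI1// oppeK.
Qed.

Lemma charge_integral_nonneg (mu : {charge set T -> \bar R})
    (m : {measure set T -> \bar R}) (f : T -> \bar R) :
  (forall U, measurable U -> mu U = m U) ->
  charge_integral mu f = (\int[m]_y f y)%E.
Proof.
move=> muE; rewrite /charge_integral.
case: (cid (Hahn_decomposition mu)) => P exN.
case: (cid exN) => N nuPN.
have [[mP Ppos] [mN Nneg] PNT PN0] := nuPN.
have negE U : measurable U -> mu (U `&` N) = 0%E.
  move=> mU; have mUN : measurable (U `&` N) by exact: measurableI.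
  apply/eqP; rewrite eq_le; apply/andP; split; last by rewrite muE.
  by apply: Nneg => // y [].
rewrite (eq_measure_integral m); last first.
  move=> U mU _; rewrite [LHS]jordan_posE cjordan_posE /crestr0 mem_set// /crestr.
  by rewrite -muE// [in RHS](charge_partition mu mU mP mN)// negE// adde0.
rewrite [X in (_ - X)%E](eq_measure_integral mzero).
  by rewrite integral_measure_zero sube0.
move=> U mU _; rewrite [LHS]jordan_negE cjordan_negE /crestr0 mem_set// /crestr.
by rewrite negE// oppe0.
Qed.

(** The uniformized charge is k m plus (1 - k r) times the Dirac mass at x, a
    measure when k r <= 1. *)
Lemma charge_integral_uniformized (m : {measure set T -> \bar R}) (k : R) (f : T -> R) :
  (forall U, measurable U -> m U = nu (U `\ x)) ->
  0 <= k -> k * r <= 1 -> m.-integrable setT (EFin \o f) ->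
  charge_integral (cadd (cscale k nu)
      (charge_of_finite_measure (\d_x : {finite_measure set T -> \bar R})))
    (EFin \o f) = (k%:E * \int[m]_y (f y)%:E + ((1 - k * r) * f x)%:E)%E.
Proof.
move=> mE k0 kr1 intf.
have kr0 : 0 <= 1 - k * r by rewrite subr_ge0.
have mf : measurable_fun setT f by apply/measurable_EFinP; exact: measurable_int intf.
pose m1 := mscale (NngNum k0) m.
pose m2 := mscale (NngNum kr0) (\d_x : {measure set T -> \bar R}).
rewrite (@charge_integral_nonneg _ (measure_add m1 m2)).
  rewrite integral_measure_add//; last 2 first.
  - exact: integrable_mscale.
  - by apply: integrable_mscale; exact: integrable_dirac.
  rewrite !integral_mscale//=; last exact: integrable_dirac.
  rewrite integral_dirac ?diracE ?in_setT ?mul1e//.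
  exact/measurable_EFinP.
move=> U mU; rewrite [RHS]measure_addE.
change (k%:E * nu U + \d_x U = k%:E * m U + (1 - k * r)%:E * \d_x U)%E.
have -> : (nu U = m U - r%:E * \d_x U)%E.
  by rewrite mE// chargeD// charge_setI1// oppeK -[RHS]addeA subee ?adde0.
have : m U \is a fin_num by rewrite mE// fin_num_measure//; exact: measurableD.
case: (m U) => // s _; rewrite diracE.
case: (x \in U) => /=; rewrite -?EFinM -?EFinN -?EFinD; congr EFin; lra.
Qed.

End one_point_charge.

Lemma measurable_singleton (S : ptopologicalType) (D : nat -> set S) (x : S) :
  (forall n, open (D n)) -> separating D -> measurable ([set x] : set (borel S)).
Proof.
move=> oD sepD.
rewrite (_ : [set x] = \bigcap_n (if x \in D n then D n else ~` D n)).
  apply: bigcap_measurable => [|n _]; first by exists 0%N.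
  have mD : measurable (D n : set (borel S)) by apply: sub_sigma_algebra; exact: oD.
  by case: ifP => _ //; exact: measurableC.
apply/seteqP; split=> [_ -> n _|y Hy]; first by case: ifPn => //; rewrite ?inE ?notin_setE.
apply: sepD => n; have := Hy n I; case: ifPn.
  by rewrite inE.
by move=> /negP; rewrite inE.
Qed.

(** * Joint measurability of the transition rates *)

Section transition_kernel.
Variables (R : realType) (S A : ptopologicalType) (D : nat -> set S).
Variables (K : set (borel S * borel A)) (q : S -> A -> {charge set (borel S) -> \bar R}).
Hypotheses (oD : forall n, open (D n)) (sepD : separating D) (mK : measurable K).
Hypothesis q_kernel : forall G : set (borel S), measurable G ->
  measurable_fun K (fun xa => q xa.1 xa.2 G).
Hypothesis q_ge0 : forall x a, K (x, a) -> forall G : set (borel S), measurable G ->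
  (0 <= q x a (G `\ x))%E.
Hypothesis q_cons : forall x a, K (x, a) -> q x a [set: borel S] = 0%E.

Let mD n : measurable (D n : set (borel S)).
Proof. by apply: sub_sigma_algebra; exact: oD. Qed.

Let mx (x : S) : measurable ([set x] : set (borel S)).
Proof. exact: (measurable_singleton x oD sepD). Qed.

Fixpoint cell (E : set (borel S)) n (x : S) : set (borel S) :=
  if n is m.+1 then cell (if x \in D m then E `&` D m else E `\` D m) m x else E.

Lemma in_cell n : forall E x y,
  cell E n x y <-> E y /\ forall i, (i < n)%N -> (D i y <-> D i x).
Proof.
elim: n => [|n IH] E x y /=; first by split => // -[].
rewrite IH; case: ifPn; rewrite ?inE ?notin_setE => Dx; split.
- by move=> [[Ey Dy] Hy]; split => // i; rewrite ltnS leq_eqVlt => /orP[/eqP->|/Hy//].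
- by move=> [Ey Hy]; split; [by split => //; apply/(Hy n)|move=> i /ltnW; exact: Hy].
- by move=> [[Ey Dy] Hy]; split => // i; rewrite ltnS leq_eqVlt => /orP[/eqP->|/Hy//].
- by move=> [Ey Hy]; split; [by split => // /(Hy n (ltnSn n))|move=> i /ltnW; exact: Hy].
Qed.

Lemma measurable_cell n : forall E x, measurable E -> measurable (cell E n x).
Proof.
elim: n => [//|n IH] E x mE /=; apply: IH; case: ifP => _.
  exact: measurableI.
exact: measurableD.
Qed.

Lemma measurable_fun_cell n : forall E : set (borel S), measurable E ->
  measurable_fun K (fun xa => q xa.1 xa.2 (cell E n xa.1)).
Proof.
elim: n => [|n IH] E mE /=; first exact: q_kernel.
rewrite (_ : (fun xa => _) = (fun xa => if xa.1 \in D n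
    then q xa.1 xa.2 (cell (E `&` D n) n xa.1)
    else q xa.1 xa.2 (cell (E `\` D n) n xa.1))); last first.
  by apply/funext => xa; case: ifP.
apply: measurable_fun_if => //.
- apply: (measurable_fun_bool true).
  rewrite (_ : _ @^-1` _ = D n `*` [set: borel A]).
    by apply: measurableI => //; apply: measurableX.
  apply/seteqP; split=> [[x a]/= /set_mem|[x a]/= [Dx _]] //.
  by rewrite mem_set.
- by apply: (measurable_funS mK); [apply: subIsetl|apply: IH; exact: measurableI].
- by apply: (measurable_funS mK); [apply: subIsetl|apply: IH; exact: measurableD].
Qed.

(** The singleton moves with the state, so the kernel hypothesis does not apply
    to it; but the cells shrink to it. *)
Lemma measurable_fun_singleton : measurable_fun K (fun xa => q xa.1 xa.2 [set xa.1]).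
Proof.
apply: (emeasurable_fun_cvg _ _ (fun n => measurable_fun_cell n measurableT)) => -[x a] Kxa.
have [m [mE _]] :=
  charge_integral_one_point (mx x) (q_ge0 Kxa) (q_cons Kxa).
have qE (U : set (borel S)) : measurable U -> U x -> q x a U = (- m (~` U))%E.
  move=> mU Ux; rewrite mE; last exact: measurableC.
  rewrite (_ : ~` U `\ x = setT `\` U); last first.
    by rewrite setTD; apply/seteqP; split=> [y []//|y nU]; split => // yx; apply: nU; rewrite yx.
  by rewrite chargeD// q_cons// setTI add0e oppeK.
have mcell n : measurable (cell setT n x) by exact: measurable_cell.
have cellE n : q x a (cell setT n x) = (- m (~` cell setT n x))%E.
  by apply: qE => //; apply/in_cell.
rewrite /= qE//; under eq_fun do rewrite cellE.
apply: cvgeN; rewrite (_ : ~` [set x] = \bigcup_n ~` cell setT n x).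
  apply: nondecreasing_cvg_mu.
  - by move=> n; exact: measurableC.
  - by apply: bigcup_measurable => n _; exact: measurableC.
  - move=> n k nk; apply/subsetPset; apply: subsetC => y /in_cell[_ Hy].
    by apply/in_cell; split => // i ik; apply: Hy; exact: leq_trans nk.
rewrite -setC_bigcap; congr (~` _).
apply/seteqP; split=> [_ -> n _|y Hy]; first by apply/in_cell.
by apply: sepD => n; have /in_cell[_] := Hy n.+1 I; apply.
Qed.

Lemma jump_measure_ex xa : exists m : {measure set (borel S) -> \bar R},
  (K xa -> (forall U, measurable U -> m U = q xa.1 xa.2 (U `\ xa.1)) /\
  forall f : borel S -> R, measurable_fun setT f ->
    charge_integral (q xa.1 xa.2) (EFin \o f) =
    (\int[m]_y (f y)%:E - (fine (- q xa.1 xa.2 [set xa.1]) * f xa.1)%:E)%E) /\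
  (~ K xa -> m = mzero).
Proof.
have [Kxa|nK] := pselect (K xa); last by exists mzero.
case: xa Kxa => x a Kxa.
have [m Hm] :=
  charge_integral_one_point (mx x) (q_ge0 Kxa) (q_cons Kxa).
by exists m.
Qed.

Definition jump_measure xa := sval (cid (jump_measure_ex xa)).

Lemma jump_measureE xa : K xa -> forall U, measurable U ->
  jump_measure xa U = q xa.1 xa.2 (U `\ xa.1).
Proof. by move=> Kxa; have [/(_ Kxa)[]] := svalP (cid (jump_measure_ex xa)). Qed.

Lemma charge_integral_jump xa (f : borel S -> R) : K xa -> measurable_fun setT f ->
  charge_integral (q xa.1 xa.2) (EFin \o f) =
  (\int[jump_measure xa]_y (f y)%:E - (fine (- q xa.1 xa.2 [set xa.1]) * f xa.1)%:E)%E.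
Proof. by move=> Kxa; have [/(_ Kxa)[_ H] _] := svalP (cid (jump_measure_ex xa)); exact: H. Qed.

Lemma measurable_jump_measure (U : set (borel S)) : measurable U ->
  measurable_fun [set: borel S * borel A] (jump_measure ^~ U).
Proof.
move=> mU.
pose g (xa : borel S * borel A) := (q xa.1 xa.2 U - (\1_U xa.1)%:E * q xa.1 xa.2 [set xa.1])%E.
rewrite (_ : jump_measure ^~ U = g \_ K).
  apply/(measurable_restrictT _ mK); apply: emeasurable_funB; first exact: q_kernel.
  apply: emeasurable_funM; last exact: measurable_fun_singleton.
  apply/measurable_EFinP; apply: measurable_funTS.
  exact: (measurableT_comp (measurable_indic mU) measurable_fst).
apply/funext => xa; rewrite patchE; case: ifPn => [/set_mem Kxa|/negP nK]; last first.
  have nK' : ~ K xa by move=> Kxa; apply: nK; exact: mem_set.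
  have [_ /(_ nK')] := svalP (cid (jump_measure_ex xa)).
  by rewrite /jump_measure => ->.
rewrite jump_measureE// chargeD// /g indicE; congr (_ - _)%E.
have [xU|xU] := pselect (U xa.1).
  rewrite mem_set// mul1e (_ : U `&` _ = [set xa.1])//.
  by rewrite setIC; apply/setIidPl => y ->.
rewrite memNset// mul0e (_ : U `&` _ = set0) ?charge0//.
by rewrite -subset0 => y [Uy yx]; apply: xU; rewrite -yx.
Qed.

Lemma measurable_charge_integral (u : borel S -> R) : measurable_fun setT u ->
  measurable_fun K (fun xa => charge_integral (q xa.1 xa.2) (EFin \o u)).
Proof.
move=> mu; have mEu : measurable_fun setT (EFin \o u) by exact/measurable_EFinP.
apply: (eq_measurable_fun (fun xa => (\int[jump_measure xa]_y (u y)%:E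
    - (fine (- q xa.1 xa.2 [set xa.1]))%:E * (u xa.1)%:E)%E)).
  by move=> xa /set_mem Kxa; rewrite charge_integral_jump.
apply: emeasurable_funB.
  apply: measurable_funTS; under eq_fun do rewrite integralE.
  apply: emeasurable_funB; apply: measurable_fun_integral_kernel => //.
  - exact: measurable_jump_measure.
  - exact: measurable_funepos.
  - exact: measurable_jump_measure.
  - exact: measurable_funeneg.
apply: emeasurable_funM.
  apply/measurable_EFinP; apply: measurableT_comp => //.
  apply: measurableT_comp => //; exact: measurable_fun_singleton.
apply/measurable_EFinP; apply: measurable_funTS.
exact: (measurableT_comp mu measurable_fst).
Qed.

End transition_kernel.

(** * Lower semicontinuity *)

Section lower_semicontinuity.
Variables (R : realType) (T : topologicalType) (D : set T).

Definition real_lsc (f : T -> R) := forall a, D a -> forall t, t < f a ->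
  exists B, [/\ open B, B a & forall y, B y -> D y -> t < f y].

Lemma lower_semicontinuous_onP (f : T -> \bar R) (g : T -> R) :
  (forall a, D a -> f a = (g a)%:E) -> lower_semicontinuous_on D f <-> real_lsc g.
Proof.
move=> fg; split.
  move=> /lower_semicontinuousP lf a Da t ta.
  have /open_subspaceP[B oB BE] := lf t.
  have Bset y : D y -> (B y <-> t < g y).
    move=> Dy; split=> H.
      have : (B `&` D) y by [].
      by rewrite BE => -[/=]; rewrite fg.
    have : ([set y | (t%:E < f y)%E] `&` D) y by split => //=; rewrite fg.
    by rewrite -BE => -[].
  by exists B; split => //; [exact/Bset|move=> y By Dy; exact/Bset].
move=> lg; apply/lower_semicontinuousP => t; apply/open_subspaceP.
exists (\bigcup_(B in [set B | open B /\ forall y, B y -> D y -> t < g y]) B).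
  by apply: bigcup_open => B [].
apply/seteqP; split=> [y [[B [_ HB] By] Dy]|y [/= ty Dy]]; split => //=.
  by rewrite fg// lte_fin; exact: HB.
move: ty; rewrite fg// lte_fin => /(lg y Dy)[B [oB By HB]].
by exists B.
Qed.

Lemma real_lscD f g : real_lsc f -> real_lsc g -> real_lsc (fun a => f a + g a).
Proof.
move=> lf lg a Da t ta; pose e := (f a + g a - t) / 2.
have [|O1 [oO1 O1a H1]] := lf a Da (f a - e); first by rewrite /e; lra.
have [|O2 [oO2 O2a H2]] := lg a Da (g a - e); first by rewrite /e; lra.
exists (O1 `&` O2); split => //; first exact: openI.
by move=> y [/H1 + /H2 +] Dy => /(_ Dy) + /(_ Dy); rewrite /e; lra.
Qed.

Lemma real_lsc_cst c : real_lsc (fun=> c).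
Proof. by move=> a Da t tc; exists setT; split => //; exact: openT. Qed.

Lemma real_lscZ k f : 0 < k -> real_lsc f -> real_lsc (fun a => k * f a).
Proof.
move=> k0 lf a Da t ta; have [|B [oB Ba HB]] := lf a Da (t / k).
  by rewrite ltr_pdivrMr// mulrC.
by exists B; split => // y By Dy; have := HB y By Dy; rewrite ltr_pdivrMr// mulrC.
Qed.

Lemma real_lsc_ext f g : (forall a, D a -> g a = f a) -> real_lsc f -> real_lsc g.
Proof.
move=> gf lf a Da t; rewrite gf// => /(lf a Da)[B [oB Ba HB]].
by exists B; split => // y By Dy; rewrite gf//; exact: HB.
Qed.

Lemma real_lsc_sup f :
  (forall a, D a -> forall t, t < f a ->
    exists g, [/\ real_lsc g, t < g a & forall y, D y -> g y <= f y]) ->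
  real_lsc f.
Proof.
move=> H a Da t ta; have [g [lg tg gf]] := H a Da t ta.
have [B [oB Ba HB]] := lg a Da t tg; exists B; split => // y By Dy.
exact: lt_le_trans (HB y By Dy) (gf y Dy).
Qed.

Lemma continuous_real_lscN (f : T -> \bar R) (g : T -> R) :
  (forall a, D a -> f a = (g a)%:E) -> {within D, continuous f} ->
  real_lsc (fun a => - g a).
Proof.
move=> fg /continuousP cf a Da t ta.
have /open_subspaceP[B oB] := cf _ (@open_ereal_lt_ereal R (- t)%:E).
rewrite -[from_subspace D f]/f => BE.
have Bset y : D y -> (B y <-> t < - g y).
  move=> Dy; split=> H.
    have : (B `&` D) y by [].
    by rewrite BE => -[/=]; rewrite fg// lte_fin ltrNr.
  have : ((f @^-1` [set y | (y < (- t)%:E)%E]) `&` D) y.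
    by split => //=; rewrite fg// lte_fin ltrNr.
  by rewrite -BE => -[].
by exists B; split => //; [exact/Bset|move=> y By Dy; exact/Bset].
Qed.

End lower_semicontinuity.

(** On positive reals the inverse is the composite of the measurable functions
    [expR], the opposite and [ln]. *)
Lemma measurable_funV_gt0 d (T : measurableType d) (R : realType) (D : set T)
    (f : T -> R) : (forall x, D x -> 0 < f x) -> measurable_fun D f ->
  measurable_fun D (fun x => (f x)^-1).
Proof.
move=> f0 mf; apply: (eq_measurable_fun (fun x => expR (- ln (f x)))).
  by move=> x /set_mem Dx; rewrite expRN lnK// posrE f0.
apply: measurableT_comp => //; apply: measurableT_comp => //.
exact: measurableT_comp.
Qed.

Lemma ereal_inf_EFinP (R : realType) T (D : set T) (f : T -> R) (t : R) :
  ereal_inf [set (f a)%:E | a in D] = t%:E <->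
  (forall a, D a -> t <= f a) /\ (forall e, 0 < e -> exists2 a, D a & f a < t + e).
Proof.
split=> [E|[lb adh]].
  split=> [a Da|e e0]; first by rewrite -lee_fin -E; apply: ereal_inf_lbound; exists a.
  have [] := @lb_ereal_inf_adherent _ [set (f a)%:E | a in D] _ e0; first by rewrite E.
  by rewrite E => _ [a Da <-]; rewrite -EFinD lte_fin; exists a.
apply/eqP; rewrite eq_le; apply/andP; split.
  apply/lee_addgt0Pr => e e0; have [a Da fa] := adh e e0.
  by apply: ge_ereal_inf; exists (f a)%:E; [exists a|rewrite -EFinD lee_fin ltW].
by apply: le_ereal_inf_tmp => _ [a Da <-]; rewrite lee_fin lb.
Qed.

(** * The generator of the controlled process *)

Section rate_operator.
Variables (R : realType) (S A : ptopologicalType).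
Variables (adm : S -> set A) (q : S -> A -> {charge set (borel S) -> \bar R}).
Hypotheses (borelS : borel_space R S) (borelA : borel_space R A).
Hypothesis K_meas : measurable (state_action adm).
Hypothesis adm_neq0 : forall x, exists a, adm x a.
Hypothesis q_kernel : forall G : set (borel S), measurable G ->
  measurable_fun (state_action adm) (fun xa => q xa.1 xa.2 G).
Hypothesis q_ge0 : forall x a, adm x a -> forall G : set (borel S), measurable G ->
  (0 <= q x a (G `\ x))%E.
Hypothesis q_cons : forall x a, adm x a -> q x a [set: borel S] = 0%E.
Hypothesis q_stable : forall x, (exit_rate_sup adm q x < +oo)%E.
Variables (w : S -> R) (rho b : R).
Hypotheses (rho_ge0 : 0 <= rho) (b_ge0 : 0 <= b).
Hypothesis w_meas : measurable_fun [set: borel S] w.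
Hypothesis w_ge1 : forall x, 1 <= w x.
Hypothesis drift : forall x a, adm x a ->
  (charge_integral (q x a) (EFin \o w) <= (rho * w x + b)%:E)%E.
Hypothesis q_lsc : forall u : S -> R, measurable_fun [set: borel S] u ->
  (forall y, 0 <= u y) -> (exists C, forall y, u y <= C) ->
  forall x, lower_semicontinuous_on (adm x)
    (fun a => charge_integral (q x a) (EFin \o u)).
Hypothesis qw_cont : forall x, {within adm x,
  continuous (fun a => charge_integral (q x a) (EFin \o w))}.
Hypothesis adm_compact : forall x, compact (adm x).

Definition generator (u : S -> R) x a : R := fine (charge_integral (q x a) (EFin \o u)).

Definition max_rate x : R := fine (exit_rate_sup adm q x).

Definition w_dominated (u : S -> R) :=
  measurable_fun [set: borel S] u /\ exists C, forall y, `|u y| <= C * w y.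

Let rate x a : R := fine (- q x a [set x]).

Let w_gt0 x : 0 < w x. Proof. exact: lt_le_trans (w_ge1 x). Qed.

Let singleton_meas (x : S) : measurable ([set x] : set (borel S)).
Proof.
have [D [baseD sepD _]] := borel_space_standard borelS.
exact: (measurable_singleton x baseD.1 sepD).
Qed.

Let exit_rateE x a : exit_rate q x a = (rate x a)%:E.
Proof. by rewrite /exit_rate /rate fineK// fin_numN fin_num_measure. Qed.

Let rate_ge0 x a : adm x a -> 0 <= rate x a.
Proof.
by move=> xa; apply: (exit_mass_ge0 (singleton_meas x) (q_ge0 xa) (q_cons xa)).
Qed.

Lemma exit_rate_supE x : exit_rate_sup adm q x = (max_rate x)%:E.
Proof.
rewrite /max_rate fineK// fin_numElt q_stable andbT.
have [a xa] := adm_neq0 x; apply: (@lt_le_trans _ _ (exit_rate q x a)).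
  by rewrite exit_rateE ltNyr.
by apply: ereal_sup_ubound; exists a.
Qed.

Let rate_le x a : adm x a -> rate x a <= max_rate x.
Proof.
move=> xa; rewrite -lee_fin -exit_rate_supE -exit_rateE.
by apply: ereal_sup_ubound; exists a.
Qed.

Lemma max_rate_ge0 x : 0 <= max_rate x.
Proof. by have [a xa] := adm_neq0 x; exact: le_trans (rate_ge0 xa) (rate_le xa). Qed.

Let jump_ex x a : adm x a -> exists m : {measure set (borel S) -> \bar R},
  (forall U, measurable U -> m U = q x a (U `\ x)) /\
  forall f : S -> R, measurable_fun [set: borel S] f ->
    charge_integral (q x a) (EFin \o f) = (\int[m]_y (f y)%:E - (rate x a * f x)%:E)%E.
Proof.
move=> xa; exact: (charge_integral_one_point (singleton_meas x) (q_ge0 xa) (q_cons xa)).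
Qed.

Lemma w_dominated_w : w_dominated w.
Proof. by split => //; exists 1 => y; rewrite mul1r gtr0_norm. Qed.

Lemma w_dominated_cst k : w_dominated (fun=> k).
Proof.
split; first exact: measurable_cst.
exists `|k| => y; rewrite -[leLHS]mulr1 ler_wpM2l//.
Qed.

Lemma w_dominatedD u v : w_dominated u -> w_dominated v ->
  w_dominated (fun y => u y + v y).
Proof.
move=> [mu [C Cu]] [mv [C' Cv]]; split; first exact: measurable_funD.
by exists (C + C') => y; rewrite (le_trans (ler_normD _ _))// mulrDl lerD.
Qed.

Lemma w_dominatedZ k u : w_dominated u -> w_dominated (fun y => k * u y).
Proof.
move=> [mu [C Cu]]; split; first by apply: measurable_funM => //; exact: measurable_cst.
by exists (`|k| * C) => y; rewrite normrM -mulrA ler_wpM2l.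
Qed.

Let integrable_dominated (m : {measure set (borel S) -> \bar R}) x a u : adm x a ->
  (forall f : S -> R, measurable_fun [set: borel S] f ->
    charge_integral (q x a) (EFin \o f) = (\int[m]_y (f y)%:E - (rate x a * f x)%:E)%E) ->
  w_dominated u -> m.-integrable setT (EFin \o u : borel S -> \bar R).
Proof.
move=> xa mE [mu [C Cu]].
have iw : m.-integrable setT (EFin \o w : borel S -> \bar R).
  apply/integrableP; split; first exact/measurable_EFinP.
  under eq_integral do rewrite /= gtr0_norm//.
  have := drift xa; rewrite mE//.
  by case: (integral _ _ _) => [s _|//|_]; rewrite ?ltry ?ltNyr.
apply: (@le_integrable _ (borel S) R m setT measurableT (EFin \o u)
  (fun y => C%:E * (w y)%:E)%E) => //.
- exact/measurable_EFinP.
- move=> y _; rewrite /= lee_fin (le_trans (Cu y))//; exact: ler_norm.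
- exact: integrableZl.
Qed.

(** The measure m of the jumps out of x is common to the two integrals that
    occur in the Bellman equation and in the value iteration, so that both are
    expressed by [generator]. *)
Let generator_jump x a : adm x a ->
  exists m : {measure set (borel S) -> \bar R}, [/\
    forall U, measurable U -> m U = q x a (U `\ x),
    forall u, w_dominated u -> m.-integrable setT (EFin \o u : borel S -> \bar R) &
    forall u, w_dominated u ->
    [/\ charge_integral (q x a) (EFin \o u) = (generator u x a)%:E,
        generator u x a = fine (\int[m]_y (u y)%:E) - rate x a * u x &
        charge_integral (uniformized_rate adm q x a) (EFin \o u) =
          ((generator u x a + (1 + max_rate x) * u x) / (1 + max_rate x))%:E]].
Proof.
move=> xa; have [m [mU mE]] := jump_ex xa; exists m; split => //.
  by move=> u; exact: integrable_dominated xa mE.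
move=> u du; have iu := integrable_dominated xa mE du.
have fin : (\int[m]_y (u y)%:E)%E \is a fin_num by exact: integrable_fin_num.
have E : charge_integral (q x a) (EFin \o u) =
    (fine (\int[m]_y (u y)%:E) - rate x a * u x)%:E.
  by rewrite mE; [rewrite EFinB fineK|case: du].
have M0 : 0 < 1 + max_rate x by rewrite ltr_pwDl// max_rate_ge0.
split; [by rewrite /generator E|by rewrite /generator E|].
rewrite /uniformized_rate (charge_integral_uniformized (singleton_meas x) mU _ _ iu)
  -/(max_rate x).
- rewrite /generator E -(fineK fin) -EFinM -EFinD; congr EFin => /=.
  rewrite -/(rate x a); field; exact: lt0r_neq0.
- by rewrite invr_ge0 ltW.
- by rewrite mulrC ler_pdivrMr// mul1r -/(rate x a) (le_trans (rate_le xa))// lerDr.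
Qed.

Lemma charge_integral_generator u x a : adm x a -> w_dominated u ->
  charge_integral (q x a) (EFin \o u) = (generator u x a)%:E.
Proof. by move=> /generator_jump[m [_ _ H]] /H[]. Qed.

Lemma charge_integral_uniformized_rate u x a : adm x a -> w_dominated u ->
  charge_integral (uniformized_rate adm q x a) (EFin \o u) =
  ((generator u x a + (1 + max_rate x) * u x) / (1 + max_rate x))%:E.
Proof. by move=> /generator_jump[m [_ _ H]] /H[]. Qed.

Lemma generator_linear k k' u v x a : adm x a -> w_dominated u -> w_dominated v ->
  generator (fun y => k * u y + k' * v y) x a =
  k * generator u x a + k' * generator v x a.
Proof.
move=> /generator_jump[m [_ iH H]] du dv.
have du' := w_dominatedZ k du; have dv' := w_dominatedZ k' dv.
have [_ -> _] := H _ du; have [_ -> _] := H _ dv.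
have [_ -> _] := H _ (w_dominatedD du' dv').
under eq_integral do rewrite EFinD EFinM EFinM.
rewrite integralD//; [|exact: integrableZl (iH _ du)|exact: integrableZl (iH _ dv)].
rewrite !integralZl//; [|exact: iH..].
have /fineK := integrable_fin_num measurableT (iH _ du).
have /fineK := integrable_fin_num measurableT (iH _ dv).
move=> <- <-; rewrite -!EFinM -EFinD /=; ring.
Qed.

Lemma generator_cst k x a : adm x a -> generator (fun=> k) x a = 0.
Proof.
move=> xa; have [m [mU _ H]] := generator_jump xa.
have [_ -> _] := H _ (w_dominated_cst k).
rewrite integral_cst// mU// setTD.
have -> : q x a (~` [set x]) = (rate x a)%:E.
  by rewrite -setTD chargeD// q_cons// setTI add0e -exit_rateE.
by rewrite -EFinM /= mulrC subrr.
Qed.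

(** The coefficient of u x on the left is 1 + max_rate x - rate x a, which is
    nonnegative: this is the positivity of the uniformized kernel. *)
Lemma generator_mono u v x a : adm x a -> w_dominated u -> w_dominated v ->
  (forall y, u y <= v y) ->
  generator u x a + (1 + max_rate x) * u x <= generator v x a + (1 + max_rate x) * v x.
Proof.
move=> xa du dv uv; have [m [_ iH H]] := generator_jump xa.
have [_ -> _] := H _ du; have [_ -> _] := H _ dv.
have : fine (\int[m]_y (u y)%:E) <= fine (\int[m]_y (v y)%:E).
  apply: fine_le; [exact: integrable_fin_num (iH _ _)..|].
  by apply: le_integral => //; [exact: iH..|move=> y _; rewrite lee_fin].
have : 0 <= (1 + max_rate x - rate x a) * (v x - u x).
  by rewrite mulr_ge0 ?subr_ge0// (le_trans (rate_le xa))// lerDr.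
by lra.
Qed.

Lemma generator_cvg (u_ : nat -> S -> R) u C x a : adm x a ->
  (forall n, w_dominated (u_ n)) -> w_dominated u ->
  (forall n y, `|u_ n y| <= C * w y) -> (forall y, u_ n y @[n --> \oo] --> u y) ->
  generator (u_ n) x a @[n --> \oo] --> generator u x a.
Proof.
move=> xa du_ du Cu cu; have [m [_ iH H]] := generator_jump xa.
have [_ -> _] := H _ du.
under eq_fun => n do have [_ -> _] := H _ (du_ n).
apply: cvgB; last by apply: cvgM => //; exact: cvg_cst.
apply: fine_cvg; rewrite fineK; last exact: integrable_fin_num (iH _ du).
have [//|||||_ _ +] := @dominated_convergence _ _ _ m setT measurableT
  (fun n => EFin \o u_ n : borel S -> \bar R) (EFin \o u) (fun y => (C * w y)%:E).
- by move=> n; apply/measurable_EFinP; case: (du_ n).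
- by apply/measurable_EFinP; case: du.
- by apply: aeW => y _; apply: cvg_EFin; [exact: nearW|exact: cu].
- by apply: (iH (fun y => C * w y)); apply: w_dominatedZ; exact: w_dominated_w.
- by apply: aeW => y n _; rewrite lee_fin.
- exact.
Qed.

(** For k large, v = u + k w is nonnegative. Its truncations are bounded, so
    their integrals are lower semicontinuous by assumption, and the supremum of
    these integrals is that of v. The integral of k w, to be subtracted, is
    continuous. *)
Lemma generator_lsc u x : w_dominated u -> real_lsc (adm x) (generator u x).
Proof.
move=> du; have [mu [C Cu]] := du.
pose k : R := 1 + `|C|; have k0 : 0 < k by rewrite ltr_pwDl.
have uk y : `|u y| <= k * w y.
  rewrite (le_trans (Cu y))// ler_pM2r// (le_trans (ler_norm C))// lerDr//.
pose v y := 1 * u y + k * w y.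
have dv : w_dominated v.
  by apply: w_dominatedD; apply: w_dominatedZ => //; exact: w_dominated_w.
have v0 y : 0 <= v y.
  by rewrite /v mul1r -lerBlDr sub0r; exact: lerNnormlW.
apply: (@real_lsc_ext _ _ _
    (fun a => generator v x a + k * (- generator w x a))) => [a xa|].
  rewrite /v generator_linear//; last exact: w_dominated_w.
  ring.
apply: real_lscD; last first.
  apply: real_lscZ => //; apply: (continuous_real_lscN _ (@qw_cont x)) => a xa.
  by apply: charge_integral_generator => //; exact: w_dominated_w.
(* the truncations of v are bounded, and agree with v at x from some rank on *)
pose v_ n y : R := Num.min (v y) n%:R.
have v_v y : \forall n \near \oo, v_ n y = v y.
  exists (Num.trunc (v y)).+1 => // n /= vn; apply/min_idPl.
  by rewrite ltW// (lt_le_trans (truncnS_gt (v y)))// ler_nat.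
have v_0 n y : 0 <= v_ n y by rewrite /v_ le_min v0 ler0n.
have v_le n y : v_ n y <= v y by rewrite /v_ ge_min lexx.
have mv_ n : measurable_fun [set: borel S] (v_ n).
  by apply: measurable_minr; [case: dv|exact: measurable_cst].
have [C' C'v] := dv.2.
have C'v_ n y : `|v_ n y| <= C' * w y.
  by rewrite ger0_norm// (le_trans (v_le n y))// (le_trans (ler_norm _)).
have dv_ n : w_dominated (v_ n) by split => //; exists C' => y.
apply: real_lsc_sup => a xa t ta.
have /cvgr_gt/(_ t ta) : generator (v_ n) x a @[n --> \oo] --> generator v x a.
  by apply: generator_cvg C'v_ _ => // y; exact: cvg_near_cst (v_v y).
move=> tn; have [n [tgn vx]] := filter_ex (filterI tn (v_v x)).
exists (generator (v_ n) x); split => //.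
  apply/(lower_semicontinuous_onP
    (f := fun a => charge_integral (q x a) (EFin \o v_ n))).
    by move=> a' xa'; exact: charge_integral_generator.
  by apply: q_lsc => //; exists n%:R => y; rewrite /v_ ge_min lexx orbT.
move=> a' xa'; have := generator_mono xa' (dv_ n) dv (v_le n).
by rewrite vx lerD2r.
Qed.

Lemma measurable_generator u : w_dominated u ->
  measurable_fun (state_action adm) (fun xa => generator u xa.1 xa.2).
Proof.
move=> [mu _]; apply: measurableT_comp => //.
have [D [baseD sepD _]] := borel_space_standard borelS.
exact: (measurable_charge_integral baseD.1 sepD K_meas q_kernel).
Qed.

Lemma measurable_max_rate : measurable_fun [set: borel S] max_rate.
Proof.
have [D [baseD sepD _]] := borel_space_standard borelS.
have m1 (x : S) : w_dominated (\1_[set x] : S -> R).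
  split; first exact: (measurable_indic (singleton_meas x)).
  exists 1 => y; rewrite mul1r indicE.
  by case: (_ \in _); rewrite ?normr1 ?normr0// ltW.
have E : max_rate = fine \o (fun x => - ereal_inf [set q x a [set x] | a in adm x])%E.
  by apply/funext => x; rewrite /max_rate /= /ereal_inf oppeK image_comp.
rewrite E; apply: measurableT_comp => //; apply: measurableT_comp => //.
apply: (@measurable_inf_compact_sections R S A adm (fun x a => q x a [set x])) => //.
  move=> x; apply/(lower_semicontinuous_onP (g := generator \1_[set x] x)).
    move=> a xa; have [m [mU _ H]] := generator_jump xa.
    have [_ -> _] := H _ (m1 x).
    rewrite integral_indic// setIT mU// setDv charge0 /= indicE mem_set// mulr1 sub0r.
    by rewrite EFinN -exit_rateE oppeK.
  exact: generator_lsc.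
exact: (measurable_fun_singleton baseD.1 sepD K_meas q_kernel).
Qed.

(** * Value iteration *)

Section optimality.
Variables (c0 : S -> A -> R) (alpha M c : R).
Hypothesis c0_meas : measurable_fun (state_action adm) (fun xa => c0 xa.1 xa.2).
Hypotheses (alpha_gt0 : 0 < alpha) (M_ge0 : 0 <= M) (alpha_gt_rho : rho < alpha).
Hypothesis c0_bound : forall x,
  (`|ereal_inf [set (c0 x a)%:E | a in adm x]| <= (M * w x + c)%:E)%E.
Hypothesis c0_lsc : forall x, lower_semicontinuous_on (adm x) (fun a => (c0 x a)%:E).

Definition value_bound x := M * (alpha * w x + b) / (alpha * (alpha - rho)) + c / alpha.

Definition uniformized_cost u x a : R :=
  (c0 x a + generator u x a + (1 + max_rate x) * u x) / (alpha + 1 + max_rate x).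

Definition optimal_cost u x : \bar R :=
  ereal_inf [set (uniformized_cost u x a)%:E | a in adm x].

Let u_ := value_iteration adm q c0 alpha value_bound.

Let alpha_rho : 0 < alpha - rho. Proof. by rewrite subr_gt0. Qed.

Let total_rate_gt0 x : 0 < alpha + 1 + max_rate x.
Proof. by rewrite ltr_wpDr ?max_rate_ge0// addr_gt0. Qed.

Let slope : R := M / (alpha - rho).

Let slope_ge0 : 0 <= slope. Proof. by rewrite divr_ge0// ltW. Qed.

Let value_boundE : value_bound =
  (fun y => slope * w y + (slope * b / alpha + c / alpha) * 1).
Proof.
apply/funext => y; rewrite /value_bound /slope.
by field; rewrite lt0r_neq0// lt0r_neq0.
Qed.

Let w_dominated_bound : w_dominated value_bound.
Proof.
rewrite value_boundE; apply: w_dominatedD.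
  by apply: w_dominatedZ; exact: w_dominated_w.
by apply: w_dominatedZ; exact: w_dominated_cst.
Qed.

Let generator_bound k x a : adm x a ->
  generator (fun y => k * value_bound y) x a = k * (slope * generator w x a).
Proof.
move=> xa.
rewrite (_ : (fun y => _) = fun y => (k * slope) * w y +
    (k * (slope * b / alpha + c / alpha)) * 1); last first.
  by apply/funext => y; rewrite value_boundE; ring.
rewrite generator_linear//; [|exact: w_dominated_w|exact: w_dominated_cst].
by rewrite generator_cst// mulr0 addr0 mulrA.
Qed.

(** The bound solves the Bellman equation with cost M w + c in which the
    integral of w is replaced by its upper bound rho w + b. *)
Let value_bound_drift x : M * w x + c + slope * (rho * w x + b) = alpha * value_bound x.
Proof.
rewrite value_boundE /slope.
by field; rewrite lt0r_neq0// lt0r_neq0.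
Qed.

Let generator_w_le x a : adm x a -> generator w x a <= rho * w x + b.
Proof.
move=> xa; rewrite -lee_fin -charge_integral_generator//; first exact: drift.
exact: w_dominated_w.
Qed.

Let c0_inf_real x : exists2 t, ereal_inf [set (c0 x a)%:E | a in adm x] = t%:E &
  `|t| <= M * w x + c.
Proof.
have := c0_bound x; case: (ereal_inf _) => [t|//|//].
by rewrite /= lee_fin => tM; exists t.
Qed.

(** The bound is a supersolution and its opposite a subsolution; T is
    monotone. *)
Lemma optimal_cost_bound u x : w_dominated u -> (forall y, `|u y| <= value_bound y) ->
  (`|optimal_cost u x| <= (value_bound x)%:E)%E.
Proof.
move=> du ub; have [t /ereal_inf_EFinP[c0t tc0] tM] := c0_inf_real x.
have k0 := total_rate_gt0 x; have := tM; rewrite ler_norml => /andP[tMl tMr].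
suff : ((- (value_bound x)%:E <= optimal_cost u x) &&
    (optimal_cost u x <= (value_bound x)%:E))%E.
  by case: (optimal_cost u x) => [s| |]; rewrite //= ?lee_fin ?ler_norml ?leye_eq ?leeNy_eq ?andbF.
apply/andP; split.
  apply: le_ereal_inf_tmp => _ [a xa <-].
  rewrite -EFinN lee_fin /uniformized_cost ler_pdivlMr//.
  have dB : w_dominated (fun y => -1 * value_bound y) by exact: w_dominatedZ.
  have Bu y : -1 * value_bound y <= u y.
    by have := ub y; rewrite ler_norml mulN1r => /andP[].
  have := generator_mono xa dB du Bu; rewrite generator_bound//.
  have := value_bound_drift x; have := c0t a xa.
  by have := ler_wpM2l slope_ge0 (generator_w_le xa); lra.
apply/lee_addgt0Pr => e e0.
have [|a xa ta] := tc0 (e * (alpha + 1 + max_rate x)); first exact: mulr_gt0.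
apply: ge_ereal_inf; exists (uniformized_cost u x a)%:E; first by exists a.
rewrite -EFinD lee_fin /uniformized_cost ler_pdivrMr// mulrDl.
have dB : w_dominated (fun y => 1 * value_bound y) by exact: w_dominatedZ.
have uB y : u y <= 1 * value_bound y by rewrite mul1r (le_trans _ (ub y))// ler_norm.
have := generator_mono xa du dB uB; rewrite generator_bound//.
have := value_bound_drift x.
by have := ler_wpM2l slope_ge0 (generator_w_le xa); lra.
Qed.

Let measurable_optimal_cost u : w_dominated u ->
  measurable_fun [set: borel S] (optimal_cost u).
Proof.
move=> du; have mq := measurable_max_rate.
apply: (@measurable_inf_compact_sections R S A adm
    (fun x a => (uniformized_cost u x a)%:E)) => //.
  move=> x; apply/(lower_semicontinuous_onP (g := uniformized_cost u x)) => //.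
  apply: (@real_lsc_ext _ _ _ (fun a => (alpha + 1 + max_rate x)^-1 *
      ((c0 x a + generator u x a) + (1 + max_rate x) * u x))) => [a _|].
    by rewrite mulrC.
  apply: real_lscZ; first by rewrite invr_gt0.
  apply: real_lscD; last exact: real_lsc_cst.
  apply: real_lscD; last exact: generator_lsc.
  exact/(lower_semicontinuous_onP (f := fun a => (c0 x a)%:E)).
apply/measurable_EFinP.
have mfst (f : S -> R) : measurable_fun [set: borel S] f ->
    measurable_fun (state_action adm) (fun xa => f xa.1).
  by move=> mf; apply: measurable_funTS; exact: (measurableT_comp mf measurable_fst).
apply: measurable_funM.
  apply: measurable_funD.
    by apply: measurable_funD => //; exact: measurable_generator.
  apply: (mfst (fun x => (1 + max_rate x) * u x)).
  apply: measurable_funM; last by case: du.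
  by apply: measurable_funD => //; exact: measurable_cst.
apply: (mfst (fun x => (alpha + 1 + max_rate x)^-1)).
apply: measurable_funV_gt0 => //.
by apply: measurable_funD => //; exact: measurable_cst.
Qed.

Let value_iteration_step n (v : S -> R) x : w_dominated v -> u_ n = EFin \o v ->
  u_ n.+1 x = optimal_cost v x.
Proof.
rewrite /u_ => dv uv; rewrite /= uv -/(max_rate x).
have q0 := max_rate_ge0 x; have k0 := total_rate_gt0 x.
rewrite /optimal_cost; congr ereal_inf.
apply: eq_imagel => a xa; rewrite charge_integral_uniformized_rate//.
rewrite -EFinM -EFinD; congr EFin; rewrite /uniformized_cost.
by field; rewrite !lt0r_neq0// ltr_pwDl.
Qed.

Let iterate_ex n : exists v : S -> R, [/\ u_ n = EFin \o v, w_dominated v &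
  forall x, `|v x| <= value_bound x].
Proof.
have B0 x : 0 <= value_bound x.
  have := c0_bound x; have := w_gt0 x => w0 /(le_trans (abse_ge0 _)).
  rewrite lee_fin => Mc; have := value_bound_drift x.
  have : 0 <= slope * (rho * w x + b).
    by rewrite mulr_ge0// addr_ge0// mulr_ge0// ltW.
  by move=> h e; rewrite -(pmulr_rge0 _ alpha_gt0) -e addr_ge0.
elim: n => [|n [v [uv dv vb]]].
  by exists value_bound; split => // x; rewrite ger0_norm.
pose v' x := fine (optimal_cost v x).
have v'E x : optimal_cost v x = (v' x)%:E.
  rewrite /v' fineK//; have := optimal_cost_bound x dv vb.
  by case: (optimal_cost v x).
have v'b x : `|v' x| <= value_bound x.
  by have := optimal_cost_bound x dv vb; rewrite v'E /= lee_fin.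
exists v'; split => //.
  by apply/funext => x; rewrite (value_iteration_step x dv uv) v'E.
split; first by apply: measurableT_comp => //; exact: measurable_optimal_cost.
have [_ [C HC]] := w_dominated_bound; exists C => y.
by rewrite (le_trans (v'b y))// (le_trans _ (HC y))// ler_norm.
Qed.

Let optimal_cost_mono u v x : w_dominated u -> w_dominated v ->
  (forall y, u y <= v y) -> (optimal_cost u x <= optimal_cost v x)%E.
Proof.
move=> du dv uv; apply: le_ereal_inf_tmp => _ [a xa <-].
apply: ge_ereal_inf; exists (uniformized_cost u x a)%:E; first by exists a.
rewrite lee_fin /uniformized_cost ler_pM2r ?invr_gt0//.
by have := generator_mono xa du dv uv; lra.
Qed.

(** Multiplying by the total rate and cancelling (1 + max_rate x) u x turns the
    fixed-point equation into the Bellman equation. *)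
Let fixpoint_bellman u x : optimal_cost u x = (u x)%:E -> w_dominated u ->
  (alpha * u x)%:E =
  ereal_inf [set ((c0 x a)%:E + charge_integral (q x a) (EFin \o u))%E | a in adm x].
Proof.
move=> /ereal_inf_EFinP[lb adh] du; have k0 := total_rate_gt0 x.
rewrite (_ : [set _ | a in _] = [set (c0 x a + generator u x a)%:E | a in adm x]).
  apply/esym/ereal_inf_EFinP; split=> [a xa|e e0].
    by have := lb a xa; rewrite /uniformized_cost ler_pdivlMr//; lra.
  have [|a xa] := adh (e / (alpha + 1 + max_rate x)); first exact: divr_gt0.
  rewrite /uniformized_cost ltr_pdivrMr// (mulrDl (u x)) divfK ?lt0r_neq0// => ua.
  by exists a => //; lra.
by apply: eq_imagel => a xa; rewrite charge_integral_generator.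
Qed.

Theorem value_iteration_solves_bellman : exists ustar : S -> R,
    [/\ weighted_bounded w ustar,
        bellman_equation adm q c0 alpha ustar,
        forall x, u_ n x @[n --> \oo] --> (ustar x)%:E,
        (forall n, measurable_fun [set: borel S] (u_ n)) /\
        (forall x, {homo u_ ^~ x : n m / (n <= m)%N >-> (m <= n)%E})
      & forall n x, (`|u_ n x| <= (value_bound x)%:E)%E].
Proof.
have /choice[v Hv] := iterate_ex.
have uv n : u_ n = EFin \o v n by case: (Hv n).
have dv n : w_dominated (v n) by case: (Hv n).
have vb n x : `|v n x| <= value_bound x by case: (Hv n).
have vS n x : optimal_cost (v n) x = (v n.+1 x)%:E.
  by rewrite -(value_iteration_step x (dv n) (uv n)) uv.
have v0 x : v 0%N x = value_bound x by have := uv 0%N => /(congr1 (@^~ x))[].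
have vd n : forall x, v n.+1 x <= v n x.
  elim: n => [|n IH] x; first by rewrite v0 (le_trans (ler_norm _)).
  by rewrite -lee_fin -!vS; exact: optimal_cost_mono.
have vni x : nonincreasing_seq (v ^~ x).
  by apply/nonincreasing_seqP => n; exact: vd.
have vlb x : has_lbound (range (v ^~ x)).
  exists (- value_bound x) => _ [n _ <-].
  by have := vb n x; rewrite ler_norml => /andP[].
pose us x := inf (range (v ^~ x)).
have cvu x : v n x @[n --> \oo] --> us x by exact: nonincreasing_cvgn.
have us_le n x : us x <= v n x by apply: ge_inf => //; exists n.
have usb x : `|us x| <= value_bound x.
  rewrite ler_norml; apply/andP; split.
    apply: lb_le_inf; first by exists (v 0%N x), 0%N.
    by move=> _ [n _ <-]; have := vb n x; rewrite ler_norml => /andP[].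
  by rewrite (le_trans (us_le 0%N x))// v0.
have [_ [C HC]] := w_dominated_bound.
have bC y : value_bound y <= C * w y by rewrite (le_trans (ler_norm _)).
have dus : w_dominated us.
  split; last by exists C => y; exact: le_trans (usb y) (bC y).
  by apply: (@measurable_fun_cvg _ (borel S) R setT v us) => [n|x _]; [case: (dv n)|exact: cvu].
have fix_us x : optimal_cost us x = (us x)%:E.
  apply/eqP; rewrite eq_le; apply/andP; split; last first.
    apply: le_ereal_inf_tmp => _ [a xa <-]; rewrite lee_fin.
    have cu : uniformized_cost (v n) x a @[n --> \oo] --> uniformized_cost us x a.
      apply: cvgMl; apply: cvgD; last by apply: cvgMr; exact: cvu.
      apply: cvgD; first exact: cvg_cst.
      by apply: (generator_cvg (C := C)) => // n y; exact: le_trans (vb n y) (bC y).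
    apply: (cvgr_to_ge cu); apply: nearW => n; rewrite (le_trans (us_le n.+1 x))//.
    by rewrite -lee_fin -vS; apply: ereal_inf_lbound; exists a.
  have := optimal_cost_bound x dus usb.
  have Tle n : (optimal_cost us x <= (v n.+1 x)%:E)%E.
    by rewrite -vS; apply: optimal_cost_mono.
  move: Tle; case: (optimal_cost us x) => [t Tle _|//|_ _]; last exact: leNye.
  rewrite lee_fin; apply: lb_le_inf; first by exists (v 0%N x), 0%N.
  by move=> _ [n _ <-]; rewrite (le_trans _ (vd n x))// -lee_fin.
exists us; split.
- split; first by case: dus.
  apply: (@le_lt_trans _ _ C%:E); last exact: ltry.
  apply: ge_ereal_sup => _ [x _ <-]; rewrite lee_fin ler_pdivrMr//.
  exact: le_trans (usb x) (bC x).
- by move=> x; exact: fixpoint_bellman.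
- move=> x; under eq_fun do rewrite uv; apply: cvg_EFin; first exact: nearW.
  exact: cvu.
- split=> [n|x n m nm]; first by rewrite uv; apply/measurable_EFinP; case: (dv n).
  by rewrite !uv lee_fin; exact: vni.
- by move=> n x; rewrite uv /= lee_fin.
Qed.

End optimality.

End rate_operator.

Theorem theorem4 (R : realType) (S A : ptopologicalType)
  (adm : S -> set A)
  (q : S -> A -> {charge set (borel S) -> \bar R})
  (c0 : S -> A -> R) (alpha : R)
  (borelS : borel_space R S) (borelA : borel_space R A)
  (adm_meas : forall x, measurable (adm x : set (borel A)))
  (K_meas : measurable (state_action adm))
  (K_graph : exists f : borel S -> borel A,
     measurable_fun [set: borel S] f /\ forall x, adm x (f x))
  (q_kernel : forall G : set (borel S), measurable G ->
     measurable_fun (state_action adm) (fun xa => q xa.1 xa.2 G))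
  (q_ge0 : forall x a, adm x a -> forall G : set (borel S), measurable G ->
     (0 <= q x a (G `\ x))%E)
  (q_cons : forall x a, adm x a -> q x a [set: borel S] = 0%E)
  (q_stable : forall x, (exit_rate_sup adm q x < +oo)%E)
  (c0_meas : measurable_fun (state_action adm) (fun xa => c0 xa.1 xa.2))
  (alpha_gt0 : 0 < alpha)
  (w : S -> R) (rho b M c : R)
  (w_meas : measurable_fun [set: borel S] w)
  (w_ge1 : forall x, 1 <= w x)
  (rho_ge0 : 0 <= rho) (b_ge0 : 0 <= b) (M_ge0 : 0 <= M) (c_ge0 : 0 <= c)
  (drift : forall x a, adm x a ->
     (charge_integral (q x a) (EFin \o w) <= (rho * w x + b)%:E)%E)
  (alpha_gt_rho : rho < alpha)
  (c0_bound : forall x,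
     (`|ereal_inf [set (c0 x a)%:E | a in adm x]| <= (M * w x + c)%:E)%E)
  (q_lsc : forall u : S -> R, measurable_fun [set: borel S] u ->
     (forall y, 0 <= u y) -> (exists C, forall y, u y <= C) ->
     forall x, lower_semicontinuous_on (adm x)
       (fun a => charge_integral (q x a) (EFin \o u)))
  (qw_cont : forall x, {within adm x,
     continuous (fun a => charge_integral (q x a) (EFin \o w))})
  (c0_lsc : forall x, lower_semicontinuous_on (adm x) (fun a => (c0 x a)%:E))
  (adm_compact : forall x, compact (adm x)) :
  let bnd := fun x =>
    M * (alpha * w x + b) / (alpha * (alpha - rho)) + c / alpha in
  let u_ := value_iteration adm q c0 alpha bnd in
  exists ustar : S -> R,
    [/\ weighted_bounded w ustar,
        bellman_equation adm q c0 alpha ustar,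
        forall x, u_ n x @[n --> \oo] --> (ustar x)%:E,
        (forall n, measurable_fun [set: borel S] (u_ n)) /\
        (forall x, {homo u_ ^~ x : n m / (n <= m)%N >-> (m <= n)%E})
      & forall n x, (`|u_ n x| <= (bnd x)%:E)%E].
Proof.
have adm_neq0 x : exists a, adm x a.
  by have [f [_ fK]] := K_graph; exists (f x).
exact: (value_iteration_solves_bellman borelS borelA K_meas adm_neq0 q_kernel
  q_ge0 q_cons q_stable rho_ge0 b_ge0 w_meas w_ge1 drift q_lsc qw_cont
  adm_compact c0_meas alpha_gt0 M_ge0 alpha_gt_rho c0_bound c0_lsc).
Qed.
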